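(* Let $0<\epsilon<1$ and let $f\in C^{k}([0,1]\times\mathbb{R})$, $k\geqslant 2$, with $\frac{\partial f}{\partial y}\geqslant m>0$ on $[0,1]\times\mathbb{R}$ ($m$ constant). Let $y$ be the solution of $\epsilon^2y''(x)=f(x,y(x))$ on $[0,1]$, $y(0)=y(1)=0$. Let $N$ be divisible by $4$, $q=1/4$, and assume $\lambda:=\frac{2\epsilon}{\sqrt{m}}\ln N\leqslant q$ and $\epsilon\leqslant C_0/N$ for a constant $C_0$. Let the mesh be $x_i=\varphi(i/N)$, $i=0,\dots,N$, where $$\varphi(t)=\begin{cases}\frac{\lambda}{q}t, & t\in[0,q],\\ p(t-q)^3+\frac{\lambda}{q}t, & t\in[q,1/2],\\ 1-\varphi(1-t), & t\in[1/2,1],\end{cases}\qquad p=\tfrac12\big(1-\tfrac{\lambda}{q}\big)\big(\tfrac12-q\big)^{-3},$$ and $h_i=x_{i+1}-x_i$. Let $\gamma$ be a constant with $\gamma\geqslant\frac{\partial f}{\partial y}$ on $[0,1]\times\mathbb{R}$, $\beta=\sqrt\gamma/\epsilon$, and for $i=1,\dots,N$ let $a_i=1/\sinh(\beta h_{i-1})$, $d_i=1/\tanh(\beta h_{i-1})$, $\Delta d_i=d_i-a_i$. Let $\overline{y}=(\overline{y}_0,\dots,\overline{y}_N)^T$ be the solution of $\overline{y}_0=\overline{y}_N=0$ and, for $i=1,\dots,N-1$, $$\frac{\gamma}{\Delta d_i+\Delta d_{i+1}}\Big[(3a_i+d_i+\Delta d_{i+1})(\overline{y}_{i-1}-\overline{y}_i)-(3a_{i+1}+d_{i+1}+\Delta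 d_i)(\overline{y}_i-\overline{y}_{i+1})$$ $$\qquad -\frac{f(x_{i-1},\overline{y}_{i-1})+2f(x_i,\overline{y}_i)+f(x_{i+1},\overline{y}_{i+1})}{\gamma}(\Delta d_i+\Delta d_{i+1})\Big]=0.$$ Then the scheme is uniformly convergent with respect to $\epsilon$: there is a constant $C>0$ independent of $N$ and $\epsilon$ such that $$|y(x_i)-\overline{y}_i|\leqslant\begin{cases} C\dfrac{\ln^2N}{N^2}, & i=0,\dots,\frac N4-1,\\[2mm] C\dfrac{1}{N^2}, & i=\frac N4,\dots,\frac{3N}{4},\\[2mm] C\dfrac{\ln^2N}{N^2}, & i=\frac{3N}{4}+1,\dots,N.\end{cases}$$
   Context: The mesh is a smoothed (modified) Shishkin mesh with transition point $\lambda$, refined in the boundary layers near $x=0$ and $x=1$. Constants $C$ are independent of $N$ and $\epsilon$. *)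

(* Defs.v *)
From Stdlib Require Import Reals Lra.
From Coquelicot Require Import Coquelicot.
Open Scope R_scope.

Definition strip (p : R * R) : Prop := 0 <= fst p <= 1.

Definition cont_strip (g : R -> R -> R) (x y : R) : Prop :=
  filterlim (fun p : R * R => g (fst p) (snd p))
            (within strip (locally (x, y))) (locally (g x y)).

(* f is of class C^2 on [0,1] x R: all partial derivatives of order <= 2
   exist (x-derivatives in the interior 0<x<1, y-derivatives for 0<=x<=1)
   and f together with these derivatives extends continuously to the
   closed strip. *)
Definition C2_strip (f : R -> R -> R) : Prop :=
  exists fx fy fxx fxy fyx fyy : R -> R -> R,
    (forall x y, 0 < x < 1 ->
       is_derive (fun t => f t y) x (fx x y) /\
       is_derive (fun t => fx t y) x (fxx x y) /\
       is_derive (fun t => fy t y) x (fyx x y)) /\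
    (forall x y, 0 <= x <= 1 ->
       is_derive (fun s => f x s) y (fy x y) /\
       is_derive (fun s => fx x s) y (fxy x y) /\
       is_derive (fun s => fy x s) y (fyy x y)) /\
    (forall x y, 0 <= x <= 1 ->
       cont_strip f x y /\ cont_strip fx x y /\ cont_strip fy x y /\
       cont_strip fxx x y /\ cont_strip fxy x y /\
       cont_strip fyx x y /\ cont_strip fyy x y).

Definition dfdy (f : R -> R -> R) (x y : R) : R := Derive (fun s => f x s) y.

Definition is_bvp_solution (eps : R) (f : R -> R -> R) (u : R -> R) : Prop :=
  (forall x, 0 <= x <= 1 -> continuous u x) /\
  exists u' u'' : R -> R,
    (forall x, 0 < x < 1 ->
       is_derive u x (u' x) /\ is_derive u' x (u'' x) /\
       eps ^ 2 * u'' x = f x (u x)) /\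
    u 0 = 0 /\ u 1 = 0.

Definition q : R := 1 / 4.

Definition lam (eps m : R) (N : nat) : R := 2 * eps / sqrt m * ln (INR N).

Definition pcoef (lm : R) : R := / 2 * (1 - lm / q) * / (/ 2 - q) ^ 3.

Definition phi_half (lm t : R) : R :=
  if Rle_dec t q then lm / q * t
  else pcoef lm * (t - q) ^ 3 + lm / q * t.

Definition phi (lm t : R) : R :=
  if Rle_dec t (/ 2) then phi_half lm t else 1 - phi_half lm (1 - t).

Definition mesh (eps m : R) (N i : nat) : R := phi (lam eps m N) (INR i / INR N).
Definition hstep (eps m : R) (N i : nat) : R :=
  mesh eps m N (S i) - mesh eps m N i.

Definition beta (gam eps : R) : R := sqrt gam / eps.
Definition acoef (gam eps m : R) (N i : nat) : R :=
  / sinh (beta gam eps * hstep eps m N (i - 1)).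
Definition dcoef (gam eps m : R) (N i : nat) : R :=
  / tanh (beta gam eps * hstep eps m N (i - 1)).
Definition Ddcoef (gam eps m : R) (N i : nat) : R :=
  dcoef gam eps m N i - acoef gam eps m N i.

Definition is_scheme_solution (f : R -> R -> R) (gam eps m : R) (N : nat)
    (yb : nat -> R) : Prop :=
  yb 0%nat = 0 /\ yb N = 0 /\
  forall i : nat, (1 <= i <= N - 1)%nat ->
    let a := acoef gam eps m N in
    let d := dcoef gam eps m N in
    let D := Ddcoef gam eps m N in
    let x := mesh eps m N in
    gam / (D i + D (S i)) *
      ((3 * a i + d i + D (S i)) * (yb (i - 1)%nat - yb i)
       - (3 * a (S i) + d (S i) + D i) * (yb i - yb (S i))
       - (f (x (i - 1)%nat) (yb (i - 1)%nat) + 2 * f (x i) (yb i)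
          + f (x (S i)) (yb (S i))) / gam * (D i + D (S i))) = 0.

(* Main.v *)
Require Import Defs.
From Stdlib Require Import Reals Lra Lia.
From Coquelicot Require Import Coquelicot.
Open Scope R_scope.

(* Put g(x,y) = gam y - f(x,y), so that -eps^2 u'' + gam u = G with
   G(x) = g(x, u(x)).  The three-point operator of the scheme annihilates the
   solutions of eps^2 z'' = gam z and is positive, hence the truncation error is the
   difference between a weighted mean of G around x_i and
   (G(x_{i-1}) + 2 G(x_i) + G(x_{i+1})) / 4, and it is controlled by approximating
   G by an affine function.  Inside the layers the mesh is uniform and Taylor's
   formula for G gives O(N^-2 + (ln N / N)^2 E(x_i)), where
   E(x) = exp(-sqrt m x / eps) + exp(-sqrt m (1-x) / eps); outside them G is within
   O(E + eps^2) = O(N^-2) of gam y0, with y0 the C^2 solution of f(x, y0(x)) = 0,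
   and the steps vary by O(N^-2).

   Since 0 <= g_y <= gam - m, the discrete problem satisfies a comparison
   principle.  The sequence w_{i-1} = (1 + th D_i) w_i with th = m / (4 gam) and
   D_i = tanh(beta h_{i-1} / 2) is a supersolution on every mesh; it dominates
   exp(-sqrt m x_i / eps), and w_{N/4} is at most a negative power of N, which
   absorbs ln^2 N outside the layers. *)

(** * Mean value and maximum principles *)

(** Two obstacles shape the proof. First, applied to u, the normalised three-point operator
    [gam * fitted / (D1 + D2)] is a mean of G against a positive kernel that depends on the two
    steps, whereas the scheme uses the fixed weights 1/4, 1/2, 1/4. The two means agree on
    constants, and on t - x up to a multiple of |h_i - h_{i+1}|. So only the distance of G to affine
    functions and the variation of the steps enter, and two derivatives of f suffice. Second, a
    constant barrier would leave ln^2 N / N^2 at every node, so the layer part of the truncation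
    error has to be matched by a barrier that decays too. A sampled exponential cannot serve when m
    < gam: for large h / eps its value at the neighbour nearer the layer dominates the average with
    weights 1/4, 1/2, 1/4. The ratios 1 + th D_i stay below 1 + th whatever the step is, while
    inside the layer they are comparable to exponential ratios. *)

Lemma mean_value_open (f df : R -> R) (a b : R) :
  a < b ->
  (forall x, a < x < b -> is_derive f x (df x)) ->
  (forall x, a <= x <= b -> continuity_pt f x) ->
  exists c, a < c < b /\ f b - f a = df c * (b - a).
Proof.
  intros Hab Hd Hc.
  assert (pr1 : forall c, a < c < b -> derivable_pt f c).
  { intros c Hc'. exists (df c). apply is_derive_Reals, Hd, Hc'. }
  assert (pr2 : forall c, a < c < b -> derivable_pt id c)
    by (intros; apply derivable_pt_id).
  destruct (MVT f id a b pr1 pr2 Hab Hc) as (c & Hcab & E).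
  { intros; apply derivable_continuous_pt, derivable_pt_id. }
  exists c; split; [exact Hcab|].
  assert (E1 : derive_pt f c (pr1 c Hcab) = df c).
  { apply derive_pt_eq_0, is_derive_Reals, Hd, Hcab. }
  assert (E2 : derive_pt id c (pr2 c Hcab) = 1).
  { apply derive_pt_eq_0, derivable_pt_lim_id. }
  rewrite E1, E2 in E. unfold id in E. lra.
Qed.

(** The bound on |c - x| makes the mean value theorem iterable: a second application to df between x
    and c stays within the same distance of x. *)
Lemma mean_value_two_sided (f df : R -> R) (a b x s : R) :
  a < x < b -> a <= s <= b ->
  (forall t, a < t < b -> is_derive f t (df t)) ->
  (forall t, a <= t <= b -> continuity_pt f t) ->
  exists c, a < c < b /\ Rabs (c - x) <= Rabs (s - x) /\
    f s - f x = df c * (s - x).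
Proof.
  intros Hx Hs Hd Hc.
  destruct (Rtotal_order x s) as [H|[H|H]].
  - destruct (mean_value_open f df x s H) as (c & Hc1 & E).
    + intros t Ht; apply Hd; lra.
    + intros t Ht; apply Hc; lra.
    + exists c. repeat split; try lra. rewrite !Rabs_pos_eq; lra.
  - subst s. exists x. repeat split; lra.
  - destruct (mean_value_open f df s x H) as (c & Hc1 & E).
    + intros t Ht; apply Hd; lra.
    + intros t Ht; apply Hc; lra.
    + exists c. repeat split; try lra. rewrite !Rabs_left; lra.
Qed.

Lemma is_derive_continuity_pt (f : R -> R) (x l : R) :
  is_derive f x l -> continuity_pt f x.
Proof.
  intros H. apply derivable_continuous_pt. exists l. apply is_derive_Reals, H.
Qed.

(** Two mean value steps, hence K in place of K / 2. The point s may be an end point, where only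
    continuity is assumed: mesh cells touching 0 or 1 need this. *)
Lemma taylor_first_order (G dG ddG : R -> R) (a b K x s : R) :
  a < x < b -> a <= s <= b ->
  (forall t, a <= t <= b -> continuity_pt G t) ->
  (forall t, a < t < b -> is_derive G t (dG t)) ->
  (forall t, a < t < b -> is_derive dG t (ddG t)) ->
  (forall t, a < t < b -> Rabs (ddG t) <= K) ->
  Rabs (G s - G x - dG x * (s - x)) <= K * (s - x) ^ 2.
Proof.
  intros Hx Hs Hc Hd Hdd HK.
  destruct (mean_value_two_sided G dG a b x s Hx Hs Hd Hc) as (c & Hcab & Hcx & E).
  assert (E2 : exists e, a < e < b /\ dG c - dG x = ddG e * (c - x)).
  { destruct (Rtotal_order x c) as [H|[H|H]].
    - destruct (mean_value_open dG ddG x c H) as (e & He & Ee).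
      + intros t Ht; apply Hdd; lra.
      + intros t Ht; apply (is_derive_continuity_pt _ _ (ddG t)), Hdd; lra.
      + exists e; split; lra.
    - subst c. exists x. split; [lra|ring].
    - destruct (mean_value_open dG ddG c x H) as (e & He & Ee).
      + intros t Ht; apply Hdd; lra.
      + intros t Ht; apply (is_derive_continuity_pt _ _ (ddG t)), Hdd; lra.
      + exists e; split; lra. }
  destruct E2 as (e & He & Ee).
  replace (G s - G x - dG x * (s - x)) with (ddG e * ((c - x) * (s - x)))
    by (rewrite E; replace (dG c) with (dG x + ddG e * (c - x)) by lra; ring).
  rewrite !Rabs_mult.
  rewrite <- (pow2_abs (s - x)).
  pose proof (HK e He). pose proof (Rabs_pos (ddG e)).
  pose proof (Rabs_pos (c - x)). pose proof (Rabs_pos (s - x)).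
  apply Rmult_le_compat; try nra.
Qed.

(** Since dw x = 0, a positive l makes dw positive just to the right of x, so w would exceed its
    maximum there. *)
Lemma second_derivative_at_max (w dw : R -> R) (a b x l : R) :
  a < x < b ->
  (forall t, a < t < b -> is_derive w t (dw t)) ->
  is_derive dw x l ->
  (forall t, a < t < b -> w t <= w x) ->
  l <= 0.
Proof.
  intros Hx Hd Hl Hmax.
  assert (H0 : dw x = 0).
  { assert (pr : derivable_pt w x) by (exists (dw x); apply is_derive_Reals, Hd, Hx).
    rewrite <- (deriv_maximum w a b x pr); try lra.
    - symmetry. apply derive_pt_eq_0, is_derive_Reals, Hd, Hx.
    - intros t ? ?; apply Hmax; lra. }
  destruct (Rle_lt_dec l 0) as [|Hpos]; [assumption|exfalso].
  apply is_derive_Reals in Hl.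
  destruct (Hl (l / 2)) as (del & Hdel); [lra|].
  pose (t := x + Rmin (del / 2) ((b - x) / 2)).
  pose proof (cond_pos del) as Hdp.
  assert (Ht : x < t < b /\ t - x < del).
  { unfold t, Rmin. destruct (Rle_dec (del / 2) ((b - x) / 2)); lra. }
  destruct (mean_value_open w dw x t) as (c & Hc & E); try lra.
  - intros s Hs; apply Hd; lra.
  - intros s Hs; apply (is_derive_continuity_pt _ _ (dw s)), Hd; lra.
  - pose proof (Hmax t ltac:(lra)) as Hwt.
    assert (Hdc : 0 < dw c).
    { specialize (Hdel (c - x) ltac:(lra)).
      rewrite (Rabs_pos_eq (c - x)) in Hdel by lra.
      specialize (Hdel ltac:(lra)).
      replace (x + (c - x)) with c in Hdel by ring. rewrite H0 in Hdel.
      apply Rabs_def2 in Hdel.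
      assert (Hq : l / 2 < (dw c - 0) / (c - x)) by lra.
      apply Rmult_lt_compat_r with (r := c - x) in Hq; [|lra].
      unfold Rdiv in Hq. rewrite (Rmult_assoc (dw c - 0)), Rinv_l in Hq by lra. nra. }
    nra.
Qed.

(** The sign of the second derivative is required only where w is positive, which is where
    differential inequalities of the form w'' >= b^2 w give it, and strictly, so that no
    perturbation argument arises. *)
Lemma maximum_principle (w dw ddw : R -> R) (a b : R) :
  a < b ->
  (forall t, a <= t <= b -> continuity_pt w t) ->
  (forall t, a < t < b -> is_derive w t (dw t)) ->
  (forall t, a < t < b -> is_derive dw t (ddw t)) ->
  w a <= 0 -> w b <= 0 ->
  (forall t, a < t < b -> 0 < w t -> 0 < ddw t) ->
  forall t, a <= t <= b -> w t <= 0.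
Proof.
  intros Hab Hc Hd Hdd Ha Hb Hpos t Ht.
  destruct (continuity_ab_maj w a b ltac:(lra) Hc) as (M & HM & HMab).
  destruct (Rle_lt_dec (w M) 0) as [H|H].
  { apply Rle_trans with (w M); [apply HM|]; assumption. }
  assert (HMi : a < M < b).
  { split; [destruct (Req_dec a M)|destruct (Req_dec b M)]; subst; lra. }
  pose proof (second_derivative_at_max w dw a b M (ddw M) HMi Hd (Hdd M HMi)
    (fun t Ht => HM t ltac:(lra))).
  pose proof (Hpos M HMi H). lra.
Qed.

(** * Hyperbolic functions *)

Lemma cosh2_sinh2 (x : R) : cosh x ^ 2 - sinh x ^ 2 = 1.
Proof.
  unfold cosh, sinh.
  assert (H : exp x * exp (- x) = 1) by (rewrite <- exp_plus, Rplus_opp_r; apply exp_0).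
  nra.
Qed.

Lemma sinh_pos (x : R) : 0 < x -> 0 < sinh x.
Proof. intros H. rewrite <- sinh_0. now apply sinh_lt. Qed.

Lemma cosh_ge_1 (x : R) : 1 <= cosh x.
Proof.
  assert (Hc : 0 < cosh x).
  { unfold cosh. pose proof (exp_pos x). pose proof (exp_pos (- x)). lra. }
  pose proof (cosh2_sinh2 x). nra.
Qed.

Lemma is_derive_sinh (x : R) : is_derive sinh x (cosh x).
Proof. apply is_derive_Reals, derivable_pt_lim_sinh. Qed.

Lemma is_derive_cosh (x : R) : is_derive cosh x (sinh x).
Proof. apply is_derive_Reals, derivable_pt_lim_cosh. Qed.

Lemma sinh_plus (a b : R) : sinh (a + b) = sinh a * cosh b + cosh a * sinh b.
Proof.
  unfold sinh, cosh. rewrite Ropp_plus_distr, !exp_plus. field.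
Qed.

Lemma sinh_opp (x : R) : sinh (- x) = - sinh x.
Proof. unfold sinh. rewrite Ropp_involutive. field. Qed.

Lemma cosh_opp (x : R) : cosh (- x) = cosh x.
Proof. unfold cosh. rewrite Ropp_involutive. field. Qed.

Lemma cosh_le (x y : R) : 0 <= x <= y -> cosh x <= cosh y.
Proof.
  intros [H1 [H2|H2]]; [|subst; lra].
  assert (H : sinh x < sinh y) by now apply sinh_lt.
  assert (H0 : 0 <= sinh x).
  { destruct H1 as [H1|H1]; [pose proof (sinh_pos x H1); lra|].
    subst. rewrite sinh_0; lra. }
  pose proof (cosh2_sinh2 x). pose proof (cosh2_sinh2 y).
  pose proof (cosh_ge_1 x). pose proof (cosh_ge_1 y). nra.
Qed.

Lemma sinh_ge_id (x : R) : 0 < x -> x <= sinh x.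
Proof.
  intros H. destruct (mean_value_open sinh cosh 0 x H) as (c & Hc & E).
  - intros; apply is_derive_sinh.
  - intros t _; apply (is_derive_continuity_pt _ _ (cosh t)), is_derive_sinh.
  - rewrite sinh_0 in E. pose proof (cosh_ge_1 c). nra.
Qed.

Lemma sinh_le_id_cosh (x : R) : 0 < x -> sinh x <= x * cosh x.
Proof.
  intros H. destruct (mean_value_open sinh cosh 0 x H) as (c & Hc & E).
  - intros; apply is_derive_sinh.
  - intros t _; apply (is_derive_continuity_pt _ _ (cosh t)), is_derive_sinh.
  - rewrite sinh_0 in E. pose proof (cosh_le c x ltac:(lra)). nra.
Qed.

(* This is tanh (x / 2), in the form in which it enters the scheme. *)
Definition tanh_half (x : R) : R := / tanh x - / sinh x.

Lemma tanh_half_num (x : R) : 0 < x -> tanh_half x = (cosh x - 1) / sinh x.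
Proof.
  intros H. unfold tanh_half, tanh. pose proof (sinh_pos x H). pose proof (cosh_ge_1 x).
  field. lra.
Qed.

Lemma tanh_half_eq (x : R) : 0 < x -> tanh_half x = sinh x / (cosh x + 1).
Proof.
  intros H. rewrite tanh_half_num by assumption.
  pose proof (sinh_pos x H). pose proof (cosh_ge_1 x). pose proof (cosh2_sinh2 x).
  apply Rmult_eq_reg_r with (sinh x * (cosh x + 1)); [|nra].
  field_simplify; [nra|lra|lra].
Qed.

Lemma tanh_half_pos (x : R) : 0 < x -> 0 < tanh_half x.
Proof.
  intros H. rewrite tanh_half_eq by assumption.
  pose proof (sinh_pos x H). pose proof (cosh_ge_1 x).
  apply Rdiv_lt_0_compat; lra.
Qed.

Lemma tanh_half_lt_1 (x : R) : 0 < x -> tanh_half x < 1.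
Proof.
  intros H. rewrite tanh_half_eq by assumption.
  pose proof (sinh_pos x H). pose proof (cosh_ge_1 x). pose proof (cosh2_sinh2 x).
  apply Rmult_lt_reg_r with (cosh x + 1); [lra|].
  unfold Rdiv. rewrite Rmult_assoc, Rinv_l by lra. nra.
Qed.

(** Both sides equal 1 / (2 cosh^2 (x / 2)). *)
Lemma inv_sinh_tanh_half (x : R) :
  0 < x -> / sinh x * tanh_half x = (1 - tanh_half x ^ 2) / 2.
Proof.
  intros H. rewrite tanh_half_num by assumption.
  pose proof (sinh_pos x H). pose proof (cosh2_sinh2 x).
  apply Rmult_eq_reg_r with (2 * sinh x ^ 2); [|nra].
  field_simplify; [nra|lra|lra].
Qed.

Lemma tanh_half_le_id (x : R) : 0 < x -> tanh_half x <= x.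
Proof.
  intros H. rewrite tanh_half_eq by assumption.
  pose proof (sinh_le_id_cosh x H). pose proof (cosh_ge_1 x).
  apply Rmult_le_reg_r with (cosh x + 1); [lra|].
  unfold Rdiv. rewrite Rmult_assoc, Rinv_l by lra. nra.
Qed.

Lemma tanh_half_ge_linear (x b : R) :
  0 < x <= b -> x / (cosh b + 1) <= tanh_half x.
Proof.
  intros H. rewrite tanh_half_eq by lra.
  pose proof (sinh_ge_id x ltac:(lra)). pose proof (cosh_le x b ltac:(lra)).
  pose proof (cosh_ge_1 x).
  apply Rmult_le_compat; try lra.
  - left; apply Rinv_0_lt_compat; lra.
  - apply Rinv_le_contravar; lra.
Qed.

(** After clearing denominators the claim reads sinh (x - y) + sinh x - sinh y <= 0. *)
Lemma tanh_half_le (x y : R) : 0 < x <= y -> tanh_half x <= tanh_half y.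
Proof.
  intros H. rewrite !tanh_half_eq by lra.
  pose proof (cosh_ge_1 x). pose proof (cosh_ge_1 y).
  assert (Hs : sinh x <= sinh y).
  { destruct (Req_dec x y); [subst; lra|]. left; apply sinh_lt; lra. }
  assert (Hd : sinh (x + - y) <= 0).
  { destruct (Req_dec x y); [subst; rewrite Rplus_opp_r, sinh_0; lra|].
    left. rewrite <- sinh_0. apply sinh_lt; lra. }
  rewrite sinh_plus, sinh_opp, cosh_opp in Hd.
  apply Rmult_le_reg_r with ((cosh x + 1) * (cosh y + 1)); [nra|].
  field_simplify; try lra; nra.
Qed.

(** On the function t - x the three-point operator takes the value a1 h1 - a2 h2, and b a h =
    [x_over_sinh (b * h)]. *)
Definition x_over_sinh (x : R) : R := x / sinh x.

Lemma x_over_sinh_deriv (x : R) : 0 < x ->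
  is_derive x_over_sinh x ((sinh x - x * cosh x) / sinh x ^ 2).
Proof.
  intros H. pose proof (sinh_pos x H).
  replace (sinh x - x * cosh x) with (1 * sinh x - x * cosh x) by ring.
  apply (is_derive_div (fun t => t)); [|apply is_derive_sinh|lra].
  exact (is_derive_id x).
Qed.

(** The absolute derivative (c cosh c - sinh c) / sinh^2 c is at most (cosh c - 1) / sinh c because
    c <= sinh c. The factor [tanh_half] is kept so that it cancels against the later division by D1
    + D2. *)
Lemma x_over_sinh_lipschitz_lt (x y : R) : 0 < x < y ->
  Rabs (x_over_sinh y - x_over_sinh x) <= (y - x) * tanh_half y.
Proof.
  intros H.
  destruct (mean_value_open x_over_sinh (fun x => (sinh x - x * cosh x) / sinh x ^ 2) x y)
    as (c & Hc & E); try lra.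
  - intros t Ht; apply x_over_sinh_deriv; lra.
  - intros t Ht; eapply is_derive_continuity_pt, x_over_sinh_deriv; lra.
  - rewrite E, Rabs_mult, (Rabs_pos_eq (y - x)), Rmult_comm by lra.
    apply Rmult_le_compat_l; [lra|].
    apply Rle_trans with (tanh_half c); [|apply tanh_half_le; lra].
    pose proof (sinh_pos c ltac:(lra)). pose proof (sinh_ge_id c ltac:(lra)).
    pose proof (sinh_le_id_cosh c ltac:(lra)). pose proof (cosh_ge_1 c).
    rewrite tanh_half_num by lra.
    replace ((sinh c - c * cosh c) / sinh c ^ 2)
      with (- ((c * cosh c - sinh c) / sinh c ^ 2)) by (field; lra).
    rewrite Rabs_Ropp, Rabs_pos_eq
      by (apply Rmult_le_pos; [lra|left; apply Rinv_0_lt_compat; nra]).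
    apply Rmult_le_reg_r with (sinh c ^ 2); [nra|].
    field_simplify; try lra; nra.
Qed.

Lemma x_over_sinh_lipschitz (x y : R) : 0 < x -> 0 < y ->
  Rabs (x_over_sinh x - x_over_sinh y) <= Rabs (x - y) * (tanh_half x + tanh_half y).
Proof.
  intros Hx Hy.
  pose proof (tanh_half_pos x Hx). pose proof (tanh_half_pos y Hy).
  destruct (Rtotal_order x y) as [H1|[H1|H1]].
  - rewrite (Rabs_minus_sym (x_over_sinh x)), (Rabs_minus_sym x), (Rabs_pos_eq (y - x)) by lra.
    pose proof (x_over_sinh_lipschitz_lt x y ltac:(lra)). nra.
  - subst. rewrite !Rminus_diag, Rabs_R0. lra.
  - rewrite (Rabs_pos_eq (x - y)) by lra.
    pose proof (x_over_sinh_lipschitz_lt y x ltac:(lra)). nra.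
Qed.

(** * The exponentially fitted three-point operator *)

(** In this form the signs of the off-diagonal coefficients are visible, and a constant w is sent to
    (D1 + D2) w; dividing by D1 + D2 normalises the operator. *)
Definition fitted (a1 a2 D1 D2 w0 w1 w2 : R) : R :=
  a1 * (w1 - w0) + a2 * (w1 - w2) + (D1 + D2) * w1.

Lemma is_derive_sinh_affine (A b c t : R) :
  is_derive (fun s => A * sinh (b * s + c)) t (A * (b * cosh (b * t + c))).
Proof.
  apply (is_derive_scal (fun s => sinh (b * s + c))).
  apply (is_derive_comp sinh (fun s => b * s + c) t (cosh (b * t + c)) b).
  - apply is_derive_sinh.
  - auto_derive; [exact I|ring].
Qed.

Lemma is_derive_cosh_affine (A b c t : R) :
  is_derive (fun s => A * cosh (b * s + c)) t (A * (b * sinh (b * t + c))).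
Proof.
  apply (is_derive_scal (fun s => cosh (b * s + c))).
  apply (is_derive_comp cosh (fun s => b * s + c) t (sinh (b * t + c)) b).
  - apply is_derive_cosh.
  - auto_derive; [exact I|ring].
Qed.

(* The solution z of z'' = b^2 z interpolating w at the two outer points
   satisfies the homogeneous three-point relation, and z <= w by the maximum
   principle. *)
Lemma fitted_nonneg (w dw ddw : R -> R) (x h1 h2 b : R) :
  0 < h1 -> 0 < h2 -> 0 < b ->
  (forall t, x - h1 <= t <= x + h2 -> continuity_pt w t) ->
  (forall t, x - h1 < t < x + h2 -> is_derive w t (dw t)) ->
  (forall t, x - h1 < t < x + h2 -> is_derive dw t (ddw t)) ->
  (forall t, x - h1 < t < x + h2 -> ddw t <= b ^ 2 * w t) ->
  0 <= fitted (/ sinh (b * h1)) (/ sinh (b * h2))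
         (tanh_half (b * h1)) (tanh_half (b * h2))
         (w (x - h1)) (w x) (w (x + h2)).
Proof.
  intros H1 H2 Hb Hc Hd Hdd Hineq.
  pose (s1 := sinh (b * h1)). pose (s2 := sinh (b * h2)).
  assert (Hb1 : 0 < b * h1) by nra. assert (Hb2 : 0 < b * h2) by nra.
  pose proof (sinh_pos _ Hb1) as Hs1. pose proof (sinh_pos _ Hb2) as Hs2.
  pose proof (sinh_pos (b * h1 + b * h2) ltac:(lra)) as Hs3.
  pose (s3 := sinh (b * h1 + b * h2)).
  (* Each of the two sinh terms of z vanishes at one outer point, so A and B are read off from the
     value of w at the other. *)
  pose (A := w (x + h2) / s3). pose (B := - (w (x - h1) / s3)).
  pose (c1 := - (b * (x - h1))). pose (c2 := - (b * (x + h2))).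
  pose (z := fun t => A * sinh (b * t + c1) + B * sinh (b * t + c2)).
  pose (dz := fun t => A * (b * cosh (b * t + c1)) + B * (b * cosh (b * t + c2))).
  assert (Hz : forall t, is_derive z t (dz t)).
  { intros t. unfold z, dz.
    apply (is_derive_plus (fun t => A * sinh (b * t + c1)) (fun t => B * sinh (b * t + c2)));
      apply is_derive_sinh_affine. }
  assert (Hdz : forall t, is_derive dz t (b ^ 2 * z t)).
  { intros t. unfold z.
    apply (is_derive_ext
      (fun t => (A * b) * cosh (b * t + c1) + (B * b) * cosh (b * t + c2))).
    { intros s.
      change (A * b * cosh (b * s + c1) + B * b * cosh (b * s + c2) = dz s).
      unfold dz. ring. }
    replace (b ^ 2 * (A * sinh (b * t + c1) + B * sinh (b * t + c2)))
      with ((A * b) * (b * sinh (b * t + c1)) + (B * b) * (b * sinh (b * t + c2))) by ring.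
    apply (is_derive_plus (fun t => A * b * cosh (b * t + c1))
                          (fun t => B * b * cosh (b * t + c2)));
      apply is_derive_cosh_affine. }
  assert (Hcmp : z x - w x <= 0).
  { apply (maximum_principle (fun t => z t - w t) (fun t => dz t - dw t)
      (fun t => b ^ 2 * z t - ddw t) (x - h1) (x + h2)); try lra.
    - intros t Ht. apply continuity_pt_minus; [|now apply Hc].
      apply (is_derive_continuity_pt _ _ (dz t)), Hz.
    - intros t Ht. apply (is_derive_minus z w); [apply Hz|now apply Hd].
    - intros t Ht. apply (is_derive_minus dz dw); [apply Hdz|now apply Hdd].
    - right. unfold z, A, B, c1, c2.
      replace (b * (x - h1) + - (b * (x - h1))) with 0 by ring.
      replace (b * (x - h1) + - (b * (x + h2))) with (- (b * h1 + b * h2)) by ring.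
      rewrite sinh_0, sinh_opp. fold s3. field. unfold s3; lra.
    - right. unfold z, A, B, c1, c2.
      replace (b * (x + h2) + - (b * (x + h2))) with 0 by ring.
      replace (b * (x + h2) + - (b * (x - h1))) with (b * h1 + b * h2) by ring.
      rewrite sinh_0. fold s3. field. unfold s3; lra.
    - intros t Ht Hpos. pose proof (Hineq t Ht).
      pose proof (Rmult_lt_0_compat (b ^ 2) (z t - w t) ltac:(nra) Hpos). lra. }
  assert (Hzx : z x * s3 = w (x + h2) * s1 + w (x - h1) * s2).
  { unfold z, A, B, c1, c2.
    replace (b * x + - (b * (x - h1))) with (b * h1) by ring.
    replace (b * x + - (b * (x + h2))) with (- (b * h2)) by ring.
    rewrite sinh_opp. fold s1 s2. field. unfold s3; lra. }
  unfold fitted. rewrite !tanh_half_num by assumption. fold s1 s2.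
  assert (Hs3' : s3 = s1 * cosh (b * h2) + cosh (b * h1) * s2)
    by (unfold s3; now rewrite sinh_plus).
  (* The homogeneous relation for z eliminates the outer values of w; only w x - z x with a positive
     factor remains. *)
  match goal with |- 0 <= ?e => replace e with ((w x - z x) * s3 / (s1 * s2)) end.
  - apply Rmult_le_pos; [|left; apply Rinv_0_lt_compat; unfold s1, s2; nra].
    apply Rmult_le_pos; unfold s3; lra.
  - replace ((w x - z x) * s3) with (w x * s3 - z x * s3) by ring.
    rewrite Hzx, Hs3'. field. unfold s1, s2; lra.
Qed.

(** * Local truncation error at a single node *)

Section LocalTruncation.

Variables (u du ddu : R -> R) (x h1 h2 eps gam : R).
Hypotheses (H1 : 0 < h1) (H2 : 0 < h2) (Heps : 0 < eps) (Hgam : 0 < gam).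
Hypothesis Hc : forall t, x - h1 <= t <= x + h2 -> continuity_pt u t.
Hypothesis Hd : forall t, x - h1 < t < x + h2 -> is_derive u t (du t).
Hypothesis Hdd : forall t, x - h1 < t < x + h2 -> is_derive du t (ddu t).

Let b := sqrt gam / eps.
Let a1 := / sinh (b * h1).
Let a2 := / sinh (b * h2).
Let D1 := tanh_half (b * h1).
Let D2 := tanh_half (b * h2).

Lemma fitting_parameter_pos : 0 < b.
Proof. apply Rdiv_lt_0_compat; [now apply sqrt_lt_R0|assumption]. Qed.

Lemma fitting_parameter_sqr : eps ^ 2 * b ^ 2 = gam.
Proof.
  unfold b. replace (eps ^ 2 * (sqrt gam / eps) ^ 2) with (sqrt gam * sqrt gam) by (field; lra).
  apply sqrt_sqrt; lra.
Qed.

(** An affine p satisfies gam (p / gam) - eps^2 (p / gam)'' = p. Hence w = (c0 + eta + c1 (t - x)) /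
    gam - sg u satisfies w'' <= b^2 w, and [fitted_nonneg] applies. The values 1 and -1 of sg give
    the upper and the lower estimate. *)
Lemma fitted_one_sided (sg c0 c1 eta : R) :
  (forall t, x - h1 < t < x + h2 ->
     sg * (gam * u t - eps ^ 2 * ddu t) <= c0 + c1 * (t - x) + eta) ->
  sg * (gam * fitted a1 a2 D1 D2 (u (x - h1)) (u x) (u (x + h2)))
    <= c0 * (D1 + D2) + c1 * (a1 * h1 - a2 * h2) + eta * (D1 + D2).
Proof.
  intros Hineq.
  pose proof fitting_parameter_pos as Hb. pose proof fitting_parameter_sqr as Hb2.
  pose (w := fun t => (c0 + eta + c1 * (t - x)) / gam - sg * u t).
  assert (Hw : 0 <= fitted a1 a2 D1 D2 (w (x - h1)) (w x) (w (x + h2))).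
  { apply (fitted_nonneg w (fun t => c1 / gam - sg * du t) (fun t => - (sg * ddu t)));
      try assumption.
    - intros t Ht. apply continuity_pt_minus.
      + eapply is_derive_continuity_pt.
        instantiate (1 := c1 / gam). auto_derive; [exact I|field; lra].
      + apply continuity_pt_scal. now apply Hc.
    - intros t Ht. apply (is_derive_minus (fun t => (c0 + eta + c1 * (t - x)) / gam)
        (fun t => sg * u t)).
      + auto_derive; [exact I|field; lra].
      + apply is_derive_scal. now apply Hd.
    - intros t Ht. replace (- (sg * ddu t)) with (0 - sg * ddu t) by ring.
      apply (is_derive_minus (fun _ => c1 / gam) (fun t => sg * du t)).
      + auto_derive; [exact I|ring].
      + apply is_derive_scal. now apply Hdd.
    - intros t Ht. specialize (Hineq t Ht).
      apply Rmult_le_reg_l with (eps ^ 2); [nra|].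
      replace (eps ^ 2 * (b ^ 2 * w t)) with (gam * w t) by (rewrite <- Hb2; ring).
      unfold w. replace (gam * ((c0 + eta + c1 * (t - x)) / gam - sg * u t))
        with (c0 + eta + c1 * (t - x) - sg * (gam * u t)) by (field; lra).
      lra. }
  apply Rmult_le_compat_l with (r := gam) in Hw; [|lra].
  rewrite Rmult_0_r in Hw.
  match type of Hw with 0 <= ?e =>
    replace e with ((c0 + eta) * (D1 + D2) + c1 * (a1 * h1 - a2 * h2)
      - sg * (gam * fitted a1 a2 D1 D2 (u (x - h1)) (u x) (u (x + h2)))) in Hw end.
  - lra.
  - unfold fitted, w. field. lra.
Qed.

(** Both means of G are compared with those of c0 + c1 (t - x). Each comparison costs eta, and the
    means of t - x are r, with |r| <= |h1 - h2|, and (h2 - h1) / 4. *)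
Lemma fitted_truncation (G : R -> R) (c0 c1 eta : R) :
  (forall t, x - h1 < t < x + h2 -> G t = gam * u t - eps ^ 2 * ddu t) ->
  (forall t, x - h1 <= t <= x + h2 -> Rabs (G t - (c0 + c1 * (t - x))) <= eta) ->
  Rabs (gam * fitted a1 a2 D1 D2 (u (x - h1)) (u x) (u (x + h2)) / (D1 + D2)
        - (G (x - h1) + 2 * G x + G (x + h2)) / 4)
    <= 2 * eta + 2 * Rabs c1 * Rabs (h1 - h2).
Proof.
  intros HG Hb.
  pose proof fitting_parameter_pos as Hbp.
  assert (Hb1 : 0 < b * h1) by nra. assert (Hb2 : 0 < b * h2) by nra.
  assert (HD1 : 0 < D1) by now apply tanh_half_pos.
  assert (HD2 : 0 < D2) by now apply tanh_half_pos.
  set (F := gam * fitted a1 a2 D1 D2 (u (x - h1)) (u x) (u (x + h2))).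
  assert (Hup : F <= c0 * (D1 + D2) + c1 * (a1 * h1 - a2 * h2) + eta * (D1 + D2)).
  { replace F with (1 * F) by ring. apply fitted_one_sided.
    intros t Ht. rewrite <- HG by assumption.
    specialize (Hb t ltac:(lra)). apply Rabs_le_between in Hb. lra. }
  assert (Hlo : - F <= - c0 * (D1 + D2) + - c1 * (a1 * h1 - a2 * h2) + eta * (D1 + D2)).
  { replace (- F) with (-1 * F) by ring. apply fitted_one_sided.
    intros t Ht. rewrite <- HG by assumption.
    specialize (Hb t ltac:(lra)). apply Rabs_le_between in Hb. lra. }
  assert (Hpsi : Rabs (a1 * h1 - a2 * h2) <= Rabs (h1 - h2) * (D1 + D2)).
  { pose proof (x_over_sinh_lipschitz (b * h1) (b * h2) Hb1 Hb2) as HL.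
    fold D1 D2 in HL.
    replace (x_over_sinh (b * h1) - x_over_sinh (b * h2)) with (b * (a1 * h1 - a2 * h2)) in HL.
    2: { unfold x_over_sinh, a1, a2. unfold Rdiv. ring. }
    replace (b * h1 - b * h2) with (b * (h1 - h2)) in HL by ring.
    rewrite !Rabs_mult, (Rabs_pos_eq b) in HL by lra.
    apply Rmult_le_reg_l with b; [assumption|]. rewrite <- Rmult_assoc. exact HL. }
  (* r is the normalised three-point operator evaluated on t - x. *)
  pose (r := (a1 * h1 - a2 * h2) / (D1 + D2)).
  assert (Hr : Rabs r <= Rabs (h1 - h2)).
  { unfold r. rewrite Rabs_div by lra. rewrite (Rabs_pos_eq (D1 + D2)) by lra.
    apply Rmult_le_reg_r with (D1 + D2); [lra|].
    unfold Rdiv. rewrite Rmult_assoc, Rinv_l by lra. lra. }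
  assert (HF : Rabs (F / (D1 + D2) - c0 - c1 * r) <= eta).
  { replace (F / (D1 + D2) - c0 - c1 * r)
      with ((F - c0 * (D1 + D2) - c1 * (a1 * h1 - a2 * h2)) / (D1 + D2))
      by (unfold r; field; lra).
    rewrite Rabs_div by lra. rewrite (Rabs_pos_eq (D1 + D2)) by lra.
    apply Rmult_le_reg_r with (D1 + D2); [lra|].
    unfold Rdiv. rewrite Rmult_assoc, Rinv_l by lra.
    rewrite Rmult_1_r. apply Rabs_le; lra. }
  assert (Hcr : Rabs (c1 * r) <= Rabs c1 * Rabs (h1 - h2)).
  { rewrite Rabs_mult. apply Rmult_le_compat_l; [apply Rabs_pos|exact Hr]. }
  assert (Hch : Rabs (c1 * (h1 - h2)) <= Rabs c1 * Rabs (h1 - h2))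
    by (rewrite Rabs_mult; lra).
  pose proof (Hb (x - h1) ltac:(lra)) as G0. pose proof (Hb x ltac:(lra)) as G1.
  pose proof (Hb (x + h2) ltac:(lra)) as G2.
  replace (x - h1 - x) with (- h1) in G0 by ring.
  replace (x + h2 - x) with h2 in G2 by ring.
  rewrite Rminus_diag in G1.
  apply Rabs_le_between in HF, Hcr, Hch, G0, G1, G2.
  apply Rabs_le. lra.
Qed.

End LocalTruncation.

(** * Discrete comparison principle and barrier *)

(* Works on every mesh: [a * D = (1 - D^2) / 2] turns the first-order part into
   [(D1^2 - D2^2) / (D1 + D2) = D1 - D2], which is bounded. *)
Lemma barrier_supersolution (a1 a2 D1 D2 w0 w1 w2 th gam m : R) :
  0 < m <= gam -> th = m / (4 * gam) ->
  0 < D1 < 1 -> 0 < D2 < 1 ->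
  a1 * D1 = (1 - D1 ^ 2) / 2 -> a2 * D2 = (1 - D2 ^ 2) / 2 ->
  w0 = (1 + th * D1) * w1 -> w1 = (1 + th * D2) * w2 -> 0 < w2 ->
  (gam - m) * ((w0 + 2 * w1 + w2) / 4) + m / 2 * w1
    <= gam * fitted a1 a2 D1 D2 w0 w1 w2 / (D1 + D2).
Proof.
  intros Hm Hth HD1 HD2 Ha1 Ha2 E0 E1 Hw2.
  assert (Hthg : th * gam = m / 4) by (rewrite Hth; field; lra).
  assert (Hth0 : 0 < th) by (rewrite Hth; apply Rdiv_lt_0_compat; lra).
  assert (Hth1 : th <= 1 / 4) by (apply Rmult_le_reg_r with gam; lra).
  assert (Ht2 : 0 < th * D2) by (apply Rmult_lt_0_compat; lra).
  assert (Ht1 : 0 < th * D1 <= th) by nra.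
  assert (Hw1 : 0 < w1) by (rewrite E1; apply Rmult_lt_0_compat; lra).
  assert (Hw21 : w2 <= w1) by (rewrite E1; nra).
  assert (Hw2lo : (1 - th * D2) * w1 <= w2).
  { rewrite E1. assert (0 <= (th * D2) ^ 2 * w2) by nra. nra. }
  assert (Hw0 : w0 <= (1 + th) * w1) by (rewrite E0; apply Rmult_le_compat_r; lra).
  apply Rmult_le_reg_r with (D1 + D2); [lra|].
  replace (gam * fitted a1 a2 D1 D2 w0 w1 w2 / (D1 + D2) * (D1 + D2))
    with (gam * fitted a1 a2 D1 D2 w0 w1 w2) by (field; lra).
  replace (gam * fitted a1 a2 D1 D2 w0 w1 w2)
    with (gam * (D1 + D2) * w1 + m / 8 * ((1 - D2 ^ 2) * w2 - (1 - D1 ^ 2) * w1)).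
  2: { unfold fitted. replace (w1 - w0) with (- (th * D1 * w1)) by (rewrite E0; ring).
       replace (w1 - w2) with (th * D2 * w2) by (rewrite E1; ring).
       replace (a1 * - (th * D1 * w1)) with (- (th * ((1 - D1 ^ 2) / 2) * w1))
         by (rewrite <- Ha1; ring).
       replace (a2 * (th * D2 * w2)) with (th * ((1 - D2 ^ 2) / 2) * w2)
         by (rewrite <- Ha2; ring).
       replace (m / 8) with (th * gam / 2) by lra. field. }
  assert (HA : (1 - D2 ^ 2) * w2 - (1 - D1 ^ 2) * w1 >= - (2 * (D1 + D2) * w1)).
  { assert ((1 - D2 ^ 2) * w2 >= (1 - D2 ^ 2) * ((1 - th * D2) * w1))
      by (apply Rle_ge, Rmult_le_compat_l; nra).
    assert ((1 - D2 ^ 2) * (1 - th * D2) - (1 - D1 ^ 2) >= - (2 * (D1 + D2))) by nra.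
    nra. }
  assert (HB : (gam - m) * ((w0 + 2 * w1 + w2) / 4) <= (gam - m) * w1 + m / 16 * w1).
  { assert ((w0 + 2 * w1 + w2) / 4 <= w1 + th / 4 * w1) by lra.
    assert ((gam - m) * ((w0 + 2 * w1 + w2) / 4) <= (gam - m) * (w1 + th / 4 * w1))
      by (apply Rmult_le_compat_l; lra).
    assert ((gam - m) * (th / 4 * w1) <= gam * (th / 4 * w1))
      by (apply Rmult_le_compat_r; nra).
    replace (gam * (th / 4 * w1)) with (m / 16 * w1) in *
      by (replace (m / 16) with (th * gam / 4) by lra; field).
    lra. }
  assert (HC : m / 8 * ((1 - D2 ^ 2) * w2 - (1 - D1 ^ 2) * w1)
               >= m / 8 * (- (2 * (D1 + D2) * w1)))
    by (apply Rle_ge, Rmult_le_compat_l; lra).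
  assert (HS : 0 < (D1 + D2) * w1) by nra.
  (* Balance of multiples of (D1 + D2) w1: out of the margin gam - (gam - m) = m, the first-order
     part takes m / 4 ([HC]), the average m / 16 ([HB]), and m / 2 is retained. This fixes th = m /
     (4 gam). *)
  apply Rle_trans with (((gam - m) * w1 + m / 16 * w1 + m / 2 * w1) * (D1 + D2)).
  - apply Rmult_le_compat_r; lra.
  - nra.
Qed.

Lemma fitted_swap (a1 a2 D1 D2 w0 w1 w2 : R) :
  fitted a1 a2 D1 D2 w0 w1 w2 = fitted a2 a1 D2 D1 w2 w1 w0.
Proof. unfold fitted; ring. Qed.

Lemma finite_argmax (r : nat -> R) (N : nat) :
  exists j, (j <= N)%nat /\ forall i, (i <= N)%nat -> r i <= r j.
Proof.
  induction N as [|N (j & Hj & Hmax)].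
  - exists 0%nat. split; [lia|]. intros i Hi. replace i with 0%nat by lia. lra.
  - destruct (Rle_lt_dec (r (S N)) (r j)) as [H|H].
    + exists j. split; [lia|]. intros i Hi.
      destruct (Nat.eq_dec i (S N)); [subst; lra|apply Hmax; lia].
    + exists (S N). split; [lia|]. intros i Hi.
      destruct (Nat.eq_dec i (S N)); [subst; lra|].
      apply Rle_trans with (r j); [apply Hmax; lia|lra].
Qed.

(** At a positive maximum M of e - z the operator gains gam M over its value on z, whereas the
    average of del gains at most (gam - m) M. The neighbours enter that average with nonnegative
    weights and del is increasing in e, so no restriction on the mesh arises. The form with [Rmax]
    expresses that del is bounded by (gam - m) e for positive e and by 0 otherwise. *)
Lemma discrete_comparison (N : nat) (a D e z del T : nat -> R) (gam m : R) :
  0 < m <= gam ->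
  (forall i, (1 <= i <= N)%nat -> 0 < a i /\ 0 < D i) ->
  (forall i, (i <= N)%nat -> 0 <= z i) ->
  (forall i, (i <= N)%nat -> del i <= (gam - m) * Rmax (e i) 0) ->
  e 0%nat = 0 -> e N = 0 ->
  (forall i, (S (S i) <= N)%nat ->
     gam * fitted (a (S i)) (a (S (S i))) (D (S i)) (D (S (S i)))
             (e i) (e (S i)) (e (S (S i))) / (D (S i) + D (S (S i)))
     = (del i + 2 * del (S i) + del (S (S i))) / 4 + T (S i)) ->
  (forall i, (S (S i) <= N)%nat ->
     (gam - m) * ((z i + 2 * z (S i) + z (S (S i))) / 4) + T (S i)
     <= gam * fitted (a (S i)) (a (S (S i))) (D (S i)) (D (S (S i)))
              (z i) (z (S i)) (z (S (S i))) / (D (S i) + D (S (S i)))) ->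
  forall i, (i <= N)%nat -> e i <= z i.
Proof.
  intros Hm HaD Hz Hdel He0 HeN Heq Hsup.
  destruct (finite_argmax (fun i => e i - z i) N) as (j & Hj & Hmax).
  destruct (Rle_lt_dec (e j - z j) 0) as [HM|HM].
  { intros i Hi. specialize (Hmax i Hi). simpl in Hmax. lra. }
  exfalso.
  destruct j as [|i].
  { pose proof (Hz 0%nat ltac:(lia)). lra. }
  destruct (Nat.eq_dec (S i) N) as [HN|HN].
  { rewrite HN in HM. pose proof (Hz N ltac:(lia)). lra. }
  assert (Hi : (S (S i) <= N)%nat) by lia.
  specialize (Heq i Hi). specialize (Hsup i Hi).
  pose proof (HaD (S i) ltac:(lia)) as [Ha1 HD1].
  pose proof (HaD (S (S i)) ltac:(lia)) as [Ha2 HD2].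
  pose proof (Hmax i ltac:(lia)) as M0. pose proof (Hmax (S (S i)) ltac:(lia)) as M2.
  cbv beta in M0, M2.
  set (M := e (S i) - z (S i)) in *.
  (* Both entries of [Rmax] are below z k + M: the first by maximality of M, the second because z k
     and M are nonnegative. *)
  assert (Hdel' : forall k, (k <= N)%nat -> del k <= (gam - m) * (z k + M)).
  { intros k Hk. apply Rle_trans with (1 := Hdel k Hk).
    apply Rmult_le_compat_l; [lra|]. pose proof (Hz k Hk).
    pose proof (Hmax k Hk). cbv beta in *. apply Rmax_lub; lra. }
  pose proof (Hdel' i ltac:(lia)). pose proof (Hdel' (S i) ltac:(lia)).
  pose proof (Hdel' (S (S i)) ltac:(lia)).
  set (F := fitted _ _ _ _ _ _ _) in Heq. set (Fz := fitted _ _ _ _ _ _ _) in Hsup.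
  set (S0 := D (S i) + D (S (S i))) in *.
  assert (HF : gam * F / S0 - gam * Fz / S0 >= gam * M).
  { replace (gam * F / S0 - gam * Fz / S0) with (gam * ((F - Fz) / S0)) by (unfold Rdiv; ring).
    apply Rle_ge, Rmult_le_compat_l; [lra|].
    apply Rmult_le_reg_r with S0; [unfold S0; lra|].
    replace ((F - Fz) / S0 * S0) with (F - Fz) by (field; unfold S0; lra).
    unfold F, Fz, fitted. fold S0.
    assert (0 <= a (S i) * (M - (e i - z i))) by (apply Rmult_le_pos; lra).
    assert (0 <= a (S (S i)) * (M - (e (S (S i)) - z (S (S i))))) by (apply Rmult_le_pos; lra).
    unfold M in *. lra. }
  assert (0 < m * M) by (apply Rmult_lt_0_compat; unfold M in *; lra).
  lra.
Qed.

(** * Two-sided exponential bounds for the barrier sequence *)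

Fixpoint decay (th : R) (D : nat -> R) (i : nat) : R :=
  match i with
  | O => 1
  | S j => decay th D j / (1 + th * D (S j))
  end.

Section Decay.

Variables (th : R) (D : nat -> R) (N : nat).
Hypothesis Hth : 0 < th <= 1.
Hypothesis HD : forall i, (1 <= i <= N)%nat -> 0 < D i < 1.

Lemma decay_pos (i : nat) : (i <= N)%nat -> 0 < decay th D i.
Proof.
  induction i as [|i IH]; intros Hi; simpl; [lra|].
  apply Rdiv_lt_0_compat; [apply IH; lia|]. pose proof (HD (S i) ltac:(lia)). nra.
Qed.

Lemma decay_step (i : nat) :
  (S i <= N)%nat -> decay th D i = (1 + th * D (S i)) * decay th D (S i).
Proof.
  intros Hi. simpl. pose proof (HD (S i) ltac:(lia)). field. nra.
Qed.

Lemma decay_antitone (i j : nat) :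
  (i <= j <= N)%nat -> decay th D j <= decay th D i.
Proof.
  intros [Hij HjN]. induction Hij as [|j Hij IH]; [lra|].
  apply Rle_trans with (decay th D j); [|apply IH; lia].
  rewrite (decay_step j) by lia. pose proof (HD (S j) ltac:(lia)).
  pose proof (decay_pos (S j) ltac:(lia)).
  assert (0 <= th * D (S j)) by nra. nra.
Qed.

Lemma decay_le_1 (i : nat) : (i <= N)%nat -> decay th D i <= 1.
Proof. intros Hi. apply (decay_antitone 0 i). lia. Qed.

(** Each factor 1 + th D is at most exp (th b h), and the exponents telescope. *)
Lemma decay_lower_bound (x : nat -> R) (b : R) (i : nat) :
  x 0%nat = 0 ->
  (forall j, (S j <= N)%nat -> D (S j) <= b * (x (S j) - x j)) ->
  (i <= N)%nat -> exp (- (th * b * x i)) <= decay th D i.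
Proof.
  intros Hx0 Hx. induction i as [|i IH]; intros Hi.
  - rewrite Hx0, Rmult_0_r, Ropp_0, exp_0. simpl; lra.
  - specialize (IH ltac:(lia)). specialize (Hx i Hi).
    pose proof (HD (S i) ltac:(lia)).
    rewrite decay_step in IH by lia.
    pose proof (exp_ineq1_le (th * (b * (x (S i) - x i)))) as He.
    pose proof (decay_pos (S i) Hi) as Hp.
    replace (exp (- (th * b * x (S i))))
      with (exp (- (th * b * x i)) * / exp (th * (b * (x (S i) - x i)))).
    2: { rewrite <- exp_Ropp, <- exp_plus. f_equal. ring. }
    pose proof (exp_pos (th * (b * (x (S i) - x i)))) as Hep.
    apply Rmult_le_reg_r with (exp (th * (b * (x (S i) - x i)))); [assumption|].
    rewrite Rmult_assoc, Rinv_l, Rmult_1_r by lra.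
    apply Rle_trans with (1 := IH). rewrite Rmult_comm.
    apply Rmult_le_compat_l; [lra|]. nra.
Qed.

(** With t = th delta / 2 <= 1 / 2 one has 1 / (1 + 2 t) <= 1 - t <= exp (- t); this is the origin
    of the factor 1 / 2 in the rate. *)
Lemma decay_upper_bound (delta : R) (i : nat) :
  0 < delta -> (forall j, (1 <= j <= i)%nat -> delta <= D j) -> (i <= N)%nat ->
  decay th D i <= exp (- (th * delta / 2 * INR i)).
Proof.
  intros Hdl. induction i as [|i IH]; intros Hj Hi.
  - simpl. rewrite Rmult_0_r, Ropp_0, exp_0. lra.
  - specialize (IH ltac:(intros; apply Hj; lia) ltac:(lia)).
    pose proof (Hj (S i) ltac:(lia)) as HDi. pose proof (HD (S i) ltac:(lia)).
    pose proof (decay_pos i ltac:(lia)) as Hp.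
    set (t := th * delta / 2). assert (Ht : 0 < t <= 1 / 2) by (unfold t; nra).
    rewrite S_INR.
    replace (- (t * (INR i + 1))) with (- (t * INR i) + - t) by ring.
    rewrite exp_plus. simpl. apply Rmult_le_compat; [lra| |exact IH|].
    + left; apply Rinv_0_lt_compat; nra.
    + pose proof (exp_ineq1_le (- t)) as He.
      apply Rle_trans with (1 - t); [|lra].
      apply Rmult_le_reg_r with (1 + th * D (S i)); [nra|].
      rewrite Rinv_l by nra.
      assert (2 * t <= th * D (S i)) by (unfold t; nra). nra.
Qed.

End Decay.

(** * Functions on the strip *)

(** Nothing is known of f outside the strip. Composing with this projection gives functions
    continuous on the whole plane, as required by results stated with full neighbourhoods. *)
Definition clamp (x : R) : R := Rmax 0 (Rmin 1 x).

Lemma clamp_range (x : R) : 0 <= clamp x <= 1.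
Proof.
  unfold clamp, Rmax, Rmin. destruct (Rle_dec 1 x), (Rle_dec 0 _); lra.
Qed.

Lemma clamp_id (x : R) : 0 <= x <= 1 -> clamp x = x.
Proof.
  intros H. unfold clamp. rewrite Rmin_right by lra. apply Rmax_right; lra.
Qed.

Lemma clamp_lipschitz (x y : R) : Rabs (clamp x - clamp y) <= Rabs (x - y).
Proof.
  unfold clamp, Rmax, Rmin, Rabs. destruct (Rle_dec 1 x), (Rle_dec 1 y).
  all: repeat match goal with |- context [if ?d then _ else _] => destruct d end; lra.
Qed.

Lemma cont_strip_clamp (F : R -> R -> R) :
  (forall x y, 0 <= x <= 1 -> cont_strip F x y) ->
  forall x y, continuous (fun p : R * R => F (clamp (fst p)) (snd p)) (x, y).
Proof.
  intros HF x y P HP.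
  destruct (HF (clamp x) y (clamp_range x) P HP) as [d Hd].
  exists d. intros [x' y'] [Hx Hy]. simpl in *.
  apply (Hd (clamp x', y')).
  - split; [|exact Hy]. apply Rle_lt_trans with (2 := Hx), clamp_lipschitz.
  - apply clamp_range.
Qed.

Lemma cont_strip_interior (F : R -> R -> R) (x y : R) :
  0 < x < 1 -> cont_strip F x y ->
  continuous (fun p : R * R => F (fst p) (snd p)) (x, y).
Proof.
  intros Hx HF P HP. specialize (HF P HP).
  assert (Hs : locally (x, y) strip).
  { assert (Hd : 0 < Rmin x (1 - x)) by (apply Rmin_glb_lt; lra).
    exists (mkposreal _ Hd). intros [x' y'] [H1 _]. simpl in H1.
    apply Rabs_def2 in H1. unfold minus, plus, opp in H1. simpl in H1.
    pose proof (Rmin_l x (1 - x)). pose proof (Rmin_r x (1 - x)).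
    unfold strip; simpl; lra. }
  unfold filtermap, within in *.
  apply (filter_imp (fun p => (strip p -> P (F (fst p) (snd p))) /\ strip p)).
  - intros p [H1 H2]. now apply H1.
  - now apply filter_and.
Qed.

(* Along the segment from (0,0) to (x,y), cut into n pieces shorter than the
   modulus of uniform continuity for 1, F varies by at most n. *)
Lemma cont_strip_bounded (F : R -> R -> R) (M : R) :
  (forall x y, 0 <= x <= 1 -> cont_strip F x y) ->
  exists B, 0 < B /\ forall x y, 0 <= x <= 1 -> Rabs y <= M -> Rabs (F x y) <= B.
Proof.
  intros HF. pose proof (cont_strip_clamp F HF) as HFc.
  destruct (uniform_continuity_2d (fun x y => F (clamp x) y) 0 1 (- M) M)
    with (eps := mkposreal 1 Rlt_0_1) as [d Hd].
  { intros x y _ _. apply continuity_2d_pt_filterlim. apply HFc. }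
  destruct (Rlt_le_dec M 0) as [HM|HM].
  { exists 1. split; [lra|]. intros x y _ Hy. pose proof (Rabs_pos y). lra. }
  (* One of k = n + 1 pieces moves the abscissa by at most 1 / k and the ordinate by at most M / k,
     both less than d. *)
  destruct (nfloor_ex ((1 + M) / d)) as [n [_ Hn]].
  { apply Rdiv_le_0_compat; [lra|apply cond_pos]. }
  pose proof (cond_pos d) as Hdp.
  rewrite <- S_INR in Hn. set (k := S n) in *.
  assert (Hk : 0 < INR k) by (apply lt_0_INR; unfold k; lia).
  assert (Hkd : (1 + M) / INR k < d).
  { apply Rmult_lt_reg_r with (INR k); [assumption|].
    unfold Rdiv. rewrite Rmult_assoc, Rinv_l, Rmult_1_r by lra.
    apply Rmult_lt_compat_r with (r := pos d) in Hn; [|assumption].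
    unfold Rdiv in Hn. rewrite Rmult_assoc, Rinv_l, Rmult_1_r in Hn by lra. lra. }
  exists (Rabs (F (clamp 0) 0) + INR k). split.
  { pose proof (Rabs_pos (F (clamp 0) 0)). lra. }
  intros x y Hx Hy. apply Rabs_le_between in Hy.
  assert (Hind : forall j, (j <= k)%nat ->
    Rabs (F (clamp (INR j / INR k * x)) (INR j / INR k * y))
      <= Rabs (F (clamp 0) 0) + INR j).
  { assert (Hfrac : forall j, (j <= k)%nat -> 0 <= INR j / INR k <= 1).
    { intros j Hj. split; [apply Rdiv_le_0_compat; [apply pos_INR|assumption]|].
      apply Rmult_le_reg_r with (INR k); [assumption|].
      unfold Rdiv. rewrite Rmult_assoc, Rinv_l by lra.
      pose proof (le_INR _ _ Hj). lra. }
    induction j as [|j IH]; intros Hj.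
    - simpl. unfold Rdiv. rewrite !Rmult_0_l. lra.
    - specialize (IH ltac:(lia)).
      pose proof (Hfrac j ltac:(lia)) as F0. pose proof (Hfrac (S j) Hj) as F1.
      assert (E : INR (S j) / INR k = INR j / INR k + / INR k)
        by (rewrite S_INR; field; lra).
      assert (Hi : 0 < / INR k) by now apply Rinv_0_lt_compat.
      assert (Hstep : / INR k * (1 + M) < d) by (unfold Rdiv in Hkd; lra).
      assert (Hlt : Rabs (F (clamp (INR (S j) / INR k * x)) (INR (S j) / INR k * y)
                       - F (clamp (INR j / INR k * x)) (INR j / INR k * y)) < 1).
      { apply Hd.
        - nra.
        - nra.
        - nra.
        - nra.
        - rewrite E. replace ((INR j / INR k + / INR k) * x - INR j / INR k * x)
            with (/ INR k * x) by ring.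
          apply Rabs_def1; nra.
        - rewrite E. replace ((INR j / INR k + / INR k) * y - INR j / INR k * y)
            with (/ INR k * y) by ring.
          apply Rabs_def1; nra. }
      pose proof (Rabs_triang_inv (F (clamp (INR (S j) / INR k * x)) (INR (S j) / INR k * y))
                    (F (clamp (INR j / INR k * x)) (INR j / INR k * y))).
      rewrite (S_INR j) at 3. lra. }
  specialize (Hind k ltac:(lia)).
  replace (INR k / INR k) with 1 in Hind by (field; lra).
  rewrite !Rmult_1_l, (clamp_id x Hx) in Hind. exact Hind.
Qed.

(** Differentiability in both variables follows from one partial derivative existing nearby and
    being continuous at the point, the other existing at the point alone; hence the asymmetric
    hypotheses on Fx and Fy. *)
Lemma chain_rule_strip (F Fx Fy : R -> R -> R) (w : R -> R) (x dw : R) :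
  0 < x < 1 ->
  (forall t y, 0 < t < 1 -> is_derive (fun t => F t y) t (Fx t y)) ->
  is_derive (fun s => F x s) (w x) (Fy x (w x)) ->
  cont_strip Fx x (w x) ->
  is_derive w x dw ->
  is_derive (fun t => F t (w t)) x (Fx x (w x) + Fy x (w x) * dw).
Proof.
  intros Hx HFx HFy Hc Hw.
  assert (HF : filterdiff (fun u : R * R => F (fst u) (snd u)) (locally (x, w x))
    (fun u : R * R => plus (scal (fst u) (Fx x (w x))) (scal (snd u) (Fy x (w x))))).
  { apply is_derive_filterdiff.
    - assert (Hd : 0 < Rmin x (1 - x)) by (apply Rmin_glb_lt; lra).
      exists (mkposreal _ Hd). intros [x' y'] [H1 _]. simpl in H1.
      apply Rabs_def2 in H1. unfold minus, plus, opp in H1. simpl in H1.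
      pose proof (Rmin_l x (1 - x)). pose proof (Rmin_r x (1 - x)).
      simpl. apply HFx. lra.
    - exact HFy.
    - now apply cont_strip_interior. }
  unfold is_derive.
  apply filterdiff_ext_lin with
    (fun y : R => plus (scal y (Fx x (w x))) (scal (scal y dw) (Fy x (w x)))).
  - apply (filterdiff_comp'_2 (fun t : R => t) w F x (fun t : R => t) (fun y : R => scal y dw)
      (fun a b : R => plus (scal a (Fx x (w x))) (scal b (Fy x (w x))))).
    + apply filterdiff_id.
    + exact Hw.
    + exact HF.
  - intros y. unfold scal, plus; simpl. unfold mult; simpl. ring.
Qed.

(** * Boundary layer functions *)

Definition layer (mu x : R) : R := exp (- (mu * x)) + exp (- (mu * (1 - x))).

Lemma layer_pos (mu x : R) : 0 < layer mu x.
Proof. unfold layer. pose proof (exp_pos (- (mu * x))). pose proof (exp_pos (- (mu * (1 - x)))). lra. Qed.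

Lemma exp_neg_le_1 (t : R) : 0 <= t -> exp (- t) <= 1.
Proof.
  intros Ht. rewrite <- exp_0. destruct (Req_dec t 0); [subst; rewrite Ropp_0; lra|].
  left. apply exp_increasing. lra.
Qed.

Lemma layer_le_2 (mu x : R) : 0 <= mu -> 0 <= x <= 1 -> layer mu x <= 2.
Proof.
  intros Hmu Hx. unfold layer.
  pose proof (exp_neg_le_1 (mu * x) ltac:(nra)).
  pose proof (exp_neg_le_1 (mu * (1 - x)) ltac:(nra)). lra.
Qed.

Lemma exp_le (x y : R) : x <= y -> exp x <= exp y.
Proof. intros [H|H]; [left; now apply exp_increasing|subst; lra]. Qed.

(** Over distances of order 1 / mu the layer function changes by a bounded factor, so its values on
    two layer cells, or on an interval of length eps / 2, are controlled by the one at x. *)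
Lemma layer_shift (mu x s d : R) : 0 <= mu -> Rabs (s - x) <= d ->
  layer mu s <= exp (mu * d) * layer mu x.
Proof.
  intros Hmu Hd. apply Rabs_le_between in Hd. unfold layer.
  rewrite Rmult_plus_distr_l, <- !exp_plus.
  apply Rplus_le_compat; apply exp_le; nra.
Qed.

Lemma is_derive_layer (mu x : R) :
  is_derive (layer mu) x (mu * (exp (- (mu * (1 - x))) - exp (- (mu * x)))).
Proof. unfold layer. auto_derive; [exact I|unfold minus, plus, opp; simpl; unfold Rminus; ring]. Qed.

Lemma is_derive_layer_2 (mu x : R) :
  is_derive (fun x => mu * (exp (- (mu * (1 - x))) - exp (- (mu * x)))) x (mu ^ 2 * layer mu x).
Proof. unfold layer. auto_derive; [exact I|unfold Rminus; ring]. Qed.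

(** * The reduced solution *)

Section Reaction.

Variables (f fx fy fxx fxy fyx fyy : R -> R -> R) (m gam : R).
Hypothesis Hdx : forall x y, 0 < x < 1 ->
  is_derive (fun t => f t y) x (fx x y) /\
  is_derive (fun t => fx t y) x (fxx x y) /\
  is_derive (fun t => fy t y) x (fyx x y).
Hypothesis Hdy : forall x y, 0 <= x <= 1 ->
  is_derive (fun s => f x s) y (fy x y) /\
  is_derive (fun s => fx x s) y (fxy x y) /\
  is_derive (fun s => fy x s) y (fyy x y).
Hypothesis Hcont : forall x y, 0 <= x <= 1 ->
  cont_strip f x y /\ cont_strip fx x y /\ cont_strip fy x y /\
  cont_strip fxx x y /\ cont_strip fxy x y /\
  cont_strip fyx x y /\ cont_strip fyy x y.
Hypothesis Hm : 0 < m.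
Hypothesis Hlo : forall x y, 0 <= x <= 1 -> m <= fy x y.
Hypothesis Hhi : forall x y, 0 <= x <= 1 -> fy x y <= gam.

Lemma reaction_increment (x y1 y2 : R) : 0 <= x <= 1 ->
  exists c, Rmin y1 y2 <= c <= Rmax y1 y2 /\ f x y2 - f x y1 = fy x c * (y2 - y1).
Proof.
  intros Hx.
  destruct (MVT_gen (fun s => f x s) y1 y2 (fun s => fy x s)) as (c & Hc & E).
  - intros s _. now apply Hdy.
  - intros s _. apply (is_derive_continuity_pt _ _ (fy x s)). now apply Hdy.
  - now exists c.
Qed.

Lemma reaction_lipschitz (x y1 y2 : R) : 0 <= x <= 1 ->
  Rabs (f x y2 - f x y1) <= gam * Rabs (y2 - y1).
Proof.
  intros Hx. destruct (reaction_increment x y1 y2 Hx) as (c & _ & ->).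
  rewrite Rabs_mult. apply Rmult_le_compat_r; [apply Rabs_pos|].
  pose proof (Hlo x c Hx). pose proof (Hhi x c Hx). rewrite Rabs_pos_eq; lra.
Qed.

Lemma reaction_expanding (x y1 y2 : R) : 0 <= x <= 1 ->
  m * Rabs (y2 - y1) <= Rabs (f x y2 - f x y1).
Proof.
  intros Hx. destruct (reaction_increment x y1 y2 Hx) as (c & _ & ->).
  rewrite Rabs_mult. apply Rmult_le_compat_r; [apply Rabs_pos|].
  pose proof (Hlo x c Hx). rewrite Rabs_pos_eq; lra.
Qed.

Lemma reaction_strongly_monotone (x y1 y2 : R) : 0 <= x <= 1 -> y1 <= y2 ->
  m * (y2 - y1) <= f x y2 - f x y1 <= gam * (y2 - y1).
Proof.
  intros Hx Hy. destruct (reaction_increment x y1 y2 Hx) as (c & _ & ->).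
  pose proof (Hlo x c Hx). pose proof (Hhi x c Hx). split; nra.
Qed.

(** The slope in y is at least m, so f changes sign within distance |f(x,0)| / m of 0. A sigma type
    is used because the root is turned into a function of x. *)
Lemma reaction_root (x : R) : 0 <= x <= 1 -> {y : R | f x y = 0}.
Proof.
  intros Hx.
  set (r := Rabs (f x 0) / m).
  assert (Hr : 0 <= r) by (apply Rdiv_le_0_compat; [apply Rabs_pos|exact Hm]).
  assert (Hmr : m * r = Rabs (f x 0)) by (unfold r; field; lra).
  destruct (IVT_gen (fun s => f x s) (- r) r 0) as (y & _ & Hy).
  - intros s. apply (is_derive_continuity_pt _ _ (fy x s)). now apply Hdy.
  - pose proof (reaction_strongly_monotone x (- r) 0 Hx ltac:(lra)) as [H1 _].
    pose proof (reaction_strongly_monotone x 0 r Hx Hr) as [H2 _].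
    pose proof (Rle_abs (f x 0)). pose proof (Rle_abs (- f x 0)) as H3.
    rewrite Rabs_Ropp in H3.
    split.
    + apply Rle_trans with (1 := Rmin_l _ _). lra.
    + apply Rle_trans with (2 := Rmax_r _ _). lra.
  - now exists y.
Qed.

(** Clamping makes the root defined on the whole line and continuous also across 0 and 1. *)
Definition reduced (x : R) : R := proj1_sig (reaction_root (clamp x) (clamp_range x)).

Lemma reduced_root_clamp (x : R) : f (clamp x) (reduced x) = 0.
Proof. unfold reduced. now destruct reaction_root. Qed.

Lemma reduced_root (x : R) : 0 <= x <= 1 -> f x (reduced x) = 0.
Proof. intros Hx. rewrite <- (reduced_root_clamp x). now rewrite clamp_id. Qed.

Lemma reduced_bounded : exists M, 0 < M /\ forall x, Rabs (reduced x) <= M.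
Proof.
  destruct (cont_strip_bounded f 0) as (B & HB & Hf).
  { intros; now apply Hcont. }
  exists (B / m). split; [now apply Rdiv_lt_0_compat|].
  intros x.
  pose proof (reaction_expanding (clamp x) 0 (reduced x) (clamp_range x)) as H.
  rewrite reduced_root_clamp, Rminus_0_r in H.
  replace (0 - f (clamp x) 0) with (- f (clamp x) 0) in H by ring.
  rewrite Rabs_Ropp in H.
  specialize (Hf (clamp x) 0 (clamp_range x) ltac:(rewrite Rabs_R0; lra)).
  apply Rmult_le_reg_l with m; [exact Hm|].
  replace (m * (B / m)) with B by (field; lra). lra.
Qed.

(** m |y0 t - y0 x| is at most |f(t, y0 x)| with t clamped, which tends to f(x, y0 x) = 0. *)
Lemma reduced_continuous (x : R) : continuity_pt reduced x.
Proof.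
  apply continuity_pt_filterlim. apply filterlim_locally. intros [e He].
  assert (Hf := cont_strip_clamp f (fun x y Hx => proj1 (Hcont x y Hx)) x (reduced x)).
  assert (Hme : 0 < m * e) by now apply Rmult_lt_0_compat.
  destruct (proj1 (filterlim_locally _ _) Hf (mkposreal _ Hme)) as [d Hd].
  exists d. intros t Ht.
  specialize (Hd (t, reduced x) (conj Ht (ball_center _ _))).
  cbn -[Rabs] in Hd |- *.
  change (Rabs (f (clamp t) (reduced x) - f (clamp x) (reduced x)) < m * e) in Hd.
  change (Rabs (reduced t - reduced x) < e).
  rewrite reduced_root_clamp, Rminus_0_r in Hd.
  pose proof (reaction_expanding (clamp t) (reduced t) (reduced x) (clamp_range t)) as H.
  rewrite reduced_root_clamp, Rminus_0_r, (Rabs_minus_sym (reduced x)) in H.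
  apply Rmult_lt_reg_l with m; [exact Hm|]. lra.
Qed.

(* f(t, y0 t) - f(t, y0 x) = - (f(t, y0 x) - f(x, y0 x)), and the left-hand side
   is f_y(t, c) (y0 t - y0 x) with c between y0 x and y0 t. *)
Lemma is_derive_reduced (x : R) : 0 < x < 1 ->
  is_derive reduced x (- fx x (reduced x) / fy x (reduced x)).
Proof.
  intros Hx. set (y := reduced x).
  assert (Hx' : 0 <= x <= 1) by lra.
  pose proof (Hlo x y Hx') as Hfy.
  set (L := - fx x y / fy x y).
  assert (HL : fy x y * L = - fx x y) by (unfold L; field; lra).
  apply is_derive_Reals. intros e He.
  pose proof (proj1 (is_derive_Reals _ _ _) (proj1 (Hdx x y Hx))) as Hfx.
  destruct (Hfx (m * e / 2)) as [d1 Hd1]; [nra|].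
  (* Chosen so that e2 |L| <= m e / 2; the other half of m e is the tolerance for the x-derivative,
     and the division by fy >= m comes last. *)
  set (e2 := m * e / (2 * (Rabs L + 1))).
  pose proof (Rabs_pos L) as HLp.
  assert (He2 : 0 < e2) by (apply Rdiv_lt_0_compat; nra).
  destruct (proj1 (filterlim_locally _ _)
    (cont_strip_interior fy x y Hx (proj1 (proj2 (proj2 (Hcont x y Hx'))))) (mkposreal _ He2))
    as [d2 Hd2].
  destruct (proj1 (filterlim_locally _ _)
    (proj1 (continuity_pt_filterlim _ _) (reduced_continuous x)) d2) as [d3 Hd3].
  pose proof (cond_pos d1). pose proof (cond_pos d2). pose proof (cond_pos d3).
  assert (Hd : 0 < Rmin (Rmin d1 d2) (Rmin d3 (Rmin x (1 - x)))).
  { repeat apply Rmin_glb_lt; lra. }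
  exists (mkposreal _ Hd). intros h Hh0 Hh. simpl in Hh.
  assert (Hh1 : Rabs h < d1).
  { apply Rlt_le_trans with (1 := Hh).
    eapply Rle_trans; [apply Rmin_l|apply Rmin_l]. }
  assert (Hh2 : Rabs h < d2).
  { apply Rlt_le_trans with (1 := Hh).
    eapply Rle_trans; [apply Rmin_l|apply Rmin_r]. }
  assert (Hh3 : Rabs h < d3).
  { apply Rlt_le_trans with (1 := Hh).
    eapply Rle_trans; [apply Rmin_r|apply Rmin_l]. }
  assert (Hh4 : Rabs h < Rmin x (1 - x)).
  { apply Rlt_le_trans with (1 := Hh).
    eapply Rle_trans; [apply Rmin_r|apply Rmin_r]. }
  set (t := x + h).
  assert (Ht : 0 <= t <= 1).
  { pose proof (Rmin_l x (1 - x)). pose proof (Rmin_r x (1 - x)).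
    apply Rabs_def2 in Hh4. unfold t. lra. }
  specialize (Hd1 h Hh0 Hh1). fold t in Hd1 |- *. fold y.
  assert (Hty : Rabs (reduced t - y) < d2).
  { apply (Hd3 t). change (Rabs (t - x) < d3). unfold t.
    replace (x + h - x) with h by ring. exact Hh3. }
  destruct (reaction_increment t y (reduced t) Ht) as (c & Hc & E).
  rewrite (reduced_root t Ht) in E.
  assert (Hcy : Rabs (c - y) < d2).
  { apply Rle_lt_trans with (2 := Hty). revert Hc. unfold Rmin, Rmax.
    destruct (Rle_dec y (reduced t)); intros Hc; [rewrite !Rabs_pos_eq|rewrite !Rabs_left1]; lra. }
  assert (Hfc : Rabs (fy t c - fy x y) < e2).
  { apply (Hd2 (t, c)). split; [|exact Hcy].
    change (Rabs (t - x) < d2). unfold t. replace (x + h - x) with h by ring. exact Hh2. }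
  pose proof (Hlo t c Ht) as Hftc.
  rewrite (reduced_root x Hx' : f x y = 0), Rminus_0_r in Hd1.
  set (Q := f t y / h) in Hd1.
  assert (HQ : f t y = Q * h) by (unfold Q; field; exact Hh0).
  (* The error of the difference quotient splits into the variation of fy and the error of the
     difference quotient of f in x. *)
  replace ((reduced t - y) / h - L) with
    (((fy x y - fy t c) * L - (Q - fx x y)) / fy t c).
  2: { apply Rmult_eq_reg_r with (fy t c * h).
       2: { apply Rmult_integral_contrapositive_currified; lra. }
       replace (((fy x y - fy t c) * L - (Q - fx x y)) / fy t c * (fy t c * h))
         with ((fy x y * L - fy t c * L - Q + fx x y) * h) by (field; lra).
       replace (((reduced t - y) / h - L) * (fy t c * h))
         with (fy t c * (reduced t - y) - fy t c * L * h) by (field; lra).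
       rewrite <- E, HQ, HL. ring. }
  rewrite Rabs_div by lra. rewrite (Rabs_pos_eq (fy t c)) by lra.
  apply Rmult_lt_reg_r with (fy t c); [lra|].
  unfold Rdiv. rewrite Rmult_assoc, Rinv_l, Rmult_1_r by lra.
  apply Rle_lt_trans with (Rabs ((fy x y - fy t c) * L) + Rabs (Q - fx x y)).
  { unfold Rminus at 1. eapply Rle_trans; [apply Rabs_triang|]. rewrite Rabs_Ropp. lra. }
  rewrite Rabs_mult, (Rabs_minus_sym (fy x y)).
  assert (Rabs (fy t c - fy x y) * Rabs L <= m * e / 2).
  { apply Rle_trans with (e2 * (Rabs L + 1)).
    - apply Rmult_le_compat; try apply Rabs_pos; lra.
    - right. unfold e2. field. lra. }
  nra.
Qed.

Lemma is_derive_reduced_2 (x : R) : 0 < x < 1 ->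
  let y := reduced x in
  let d := - fx x y / fy x y in
  is_derive (fun x => - fx x (reduced x) / fy x (reduced x)) x
    ((- (fxx x y + fxy x y * d) * fy x y - - fx x y * (fyx x y + fyy x y * d)) / fy x y ^ 2).
Proof.
  intros Hx y d. assert (Hx' : 0 <= x <= 1) by lra.
  apply (is_derive_div (fun x => - fx x (reduced x)) (fun x => fy x (reduced x))).
  - apply (is_derive_opp (fun x => fx x (reduced x))).
    apply (chain_rule_strip fx fxx fxy reduced); try assumption.
    + intros; now apply Hdx.
    + now apply Hdy.
    + now apply Hcont.
    + now apply is_derive_reduced.
  - apply (chain_rule_strip fy fyx fyy reduced); try assumption.
    + intros; now apply Hdx.
    + now apply Hdy.
    + now apply Hcont.
    + now apply is_derive_reduced.
  - pose proof (Hlo x (reduced x) Hx'). lra.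
Qed.

Lemma partials_bounded (M : R) : exists B, 0 < B /\
  forall x y, 0 <= x <= 1 -> Rabs y <= M ->
    Rabs (fx x y) <= B /\ Rabs (fxx x y) <= B /\ Rabs (fxy x y) <= B /\
    Rabs (fyx x y) <= B /\ Rabs (fyy x y) <= B.
Proof.
  destruct (cont_strip_bounded fx M) as (B1 & H1 & K1); [intros; now apply Hcont|].
  destruct (cont_strip_bounded fxx M) as (B2 & H2 & K2); [intros; now apply Hcont|].
  destruct (cont_strip_bounded fxy M) as (B3 & H3 & K3); [intros; now apply Hcont|].
  destruct (cont_strip_bounded fyx M) as (B4 & H4 & K4); [intros; now apply Hcont|].
  destruct (cont_strip_bounded fyy M) as (B5 & H5 & K5); [intros; now apply Hcont|].
  exists (B1 + B2 + B3 + B4 + B5). split; [lra|].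
  intros x y Hx Hy. specialize (K1 x y Hx Hy). specialize (K2 x y Hx Hy).
  specialize (K3 x y Hx Hy). specialize (K4 x y Hx Hy). specialize (K5 x y Hx Hy).
  lra.
Qed.

Lemma reduced_solution_C2 : exists (y0 dy0 ddy0 : R -> R) (M : R), 0 < M /\
  (forall x, 0 <= x <= 1 -> f x (y0 x) = 0) /\
  (forall x, continuity_pt y0 x) /\
  (forall x, 0 < x < 1 -> is_derive y0 x (dy0 x)) /\
  (forall x, 0 < x < 1 -> is_derive dy0 x (ddy0 x)) /\
  (forall x, Rabs (y0 x) <= M) /\
  (forall x, 0 < x < 1 -> Rabs (dy0 x) <= M) /\
  (forall x, 0 < x < 1 -> Rabs (ddy0 x) <= M).
Proof.
  destruct reduced_bounded as (M0 & HM0 & Hred).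
  destruct (partials_bounded M0) as (B & HB & Hpart).
  set (M1 := B / m). set (M2 := 2 * (B * (1 + M1)) / m * (1 + M1)).
  assert (HM1 : 0 < M1) by now apply Rdiv_lt_0_compat.
  assert (HM2 : 0 < M2).
  { unfold M2. apply Rmult_lt_0_compat; [|lra]. apply Rdiv_lt_0_compat; nra. }
  assert (Hd : forall x, 0 < x < 1 -> Rabs (- fx x (reduced x) / fy x (reduced x)) <= M1).
  { intros x Hx. assert (Hx' : 0 <= x <= 1) by lra.
    pose proof (Hlo x (reduced x) Hx').
    pose proof (proj1 (Hpart x (reduced x) Hx' (Hred x))).
    rewrite Rabs_div by lra. rewrite Rabs_Ropp, (Rabs_pos_eq (fy _ _)) by lra.
    apply Rmult_le_compat; [apply Rabs_pos|left; apply Rinv_0_lt_compat; lra|assumption|].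
    apply Rinv_le_contravar; lra. }
  exists reduced, (fun x => - fx x (reduced x) / fy x (reduced x)),
    (fun x => let y := reduced x in let d := - fx x y / fy x y in
       (- (fxx x y + fxy x y * d) * fy x y - - fx x y * (fyx x y + fyy x y * d)) / fy x y ^ 2),
    (M0 + M1 + M2).
  refine (conj _ (conj _ (conj _ (conj _ (conj _ (conj _ (conj _ _))))))).
  - lra.
  - exact reduced_root.
  - exact reduced_continuous.
  - exact is_derive_reduced.
  - exact is_derive_reduced_2.
  - intros x. specialize (Hred x). lra.
  - intros x Hx. specialize (Hd x Hx). lra.
  - intros x Hx. cbv zeta. specialize (Hd x Hx).
    set (y := reduced x) in *. set (d := - fx x y / fy x y) in *.
    assert (Hx' : 0 <= x <= 1) by lra.
    pose proof (Hlo x y Hx') as Hfy.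
    destruct (Hpart x y Hx' (Hred x)) as (K1 & K2 & K3 & K4 & K5).
    assert (HA : forall p r, Rabs p <= B -> Rabs r <= B -> Rabs (p + r * d) <= B * (1 + M1)).
    { intros p r Hp Hr. apply Rle_trans with (1 := Rabs_triang _ _).
      rewrite Rabs_mult.
      assert (Rabs r * Rabs d <= B * M1) by (apply Rmult_le_compat; try apply Rabs_pos; lra).
      lra. }
    pose proof (HA _ _ K2 K3) as A1. pose proof (HA _ _ K4 K5) as A2.
    replace ((- (fxx x y + fxy x y * d) * fy x y - - fx x y * (fyx x y + fyy x y * d)) / fy x y ^ 2)
      with (- ((fxx x y + fxy x y * d) + d * (fyx x y + fyy x y * d)) * / fy x y)
      by (unfold d; field; lra).
    rewrite Rabs_mult, Rabs_Ropp, Rabs_inv, (Rabs_pos_eq (fy x y)) by lra.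
    assert (N1 : Rabs (fxx x y + fxy x y * d + d * (fyx x y + fyy x y * d))
              <= B * (1 + M1) * (1 + M1)).
    { apply Rle_trans with (1 := Rabs_triang _ _). rewrite Rabs_mult.
      assert (Rabs d * Rabs (fyx x y + fyy x y * d) <= M1 * (B * (1 + M1)))
        by (apply Rmult_le_compat; try apply Rabs_pos; lra).
      lra. }
    assert (N2 : / fy x y <= / m) by (apply Rinv_le_contravar; lra).
    apply Rle_trans with (B * (1 + M1) * (1 + M1) * / m).
    + apply Rmult_le_compat; [apply Rabs_pos|left; apply Rinv_0_lt_compat; lra|assumption|lra].
    + apply Rle_trans with M2; [|lra]. unfold M2, Rdiv.
      assert (0 < / m) by now apply Rinv_0_lt_compat.
      assert (0 < B * (1 + M1) * (1 + M1) * / m) by (repeat apply Rmult_lt_0_compat; lra).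
      lra.
Qed.

(** * A priori estimates for the boundary value problem *)

Section Perturbation.

Variables (y0 dy0 ddy0 : R -> R) (M : R).
Hypothesis HM : 0 < M.
Hypothesis Hy0 : forall x, 0 <= x <= 1 -> f x (y0 x) = 0.
Hypothesis Hy0c : forall x, continuity_pt y0 x.
Hypothesis Hy0d : forall x, 0 < x < 1 -> is_derive y0 x (dy0 x).
Hypothesis Hy0dd : forall x, 0 < x < 1 -> is_derive dy0 x (ddy0 x).
Hypothesis Hy0b : forall x, Rabs (y0 x) <= M.
Hypothesis Hddy0b : forall x, 0 < x < 1 -> Rabs (ddy0 x) <= M.

(** The rate mu satisfies eps^2 mu^2 = m, so the layer function E solves eps^2 E'' = m E. In the
    barrier, M E pays for the boundary values of y0, E being at least 1 at both ends, and (M / m)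
    eps^2 pays for eps^2 y0''. *)
Lemma solution_near_reduced_signed (sg eps : R) (u du ddu : R -> R) :
  sg = 1 \/ sg = -1 -> 0 < eps ->
  (forall x, 0 <= x <= 1 -> continuity_pt u x) ->
  (forall x, 0 < x < 1 -> is_derive u x (du x)) ->
  (forall x, 0 < x < 1 -> is_derive du x (ddu x)) ->
  (forall x, 0 < x < 1 -> eps ^ 2 * ddu x = f x (u x)) ->
  u 0 = 0 -> u 1 = 0 ->
  forall x, 0 <= x <= 1 ->
    sg * (u x - y0 x) <= M * layer (sqrt m / eps) x + M / m * eps ^ 2.
Proof.
  intros Hsg Heps Huc Hud Hudd Hode Hu0 Hu1.
  set (mu := sqrt m / eps).
  assert (Hmu : 0 < mu) by (apply Rdiv_lt_0_compat; [now apply sqrt_lt_R0|assumption]).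
  assert (Hmu2 : eps ^ 2 * mu ^ 2 = m).
  { unfold mu. replace (eps ^ 2 * (sqrt m / eps) ^ 2) with (sqrt m * sqrt m) by (field; lra).
    apply sqrt_sqrt; lra. }
  set (K := M / m * eps ^ 2).
  assert (HK : m * K = M * eps ^ 2) by (unfold K; field; lra).
  assert (HK0 : 0 <= K).
  { unfold K. apply Rmult_le_pos; [left; now apply Rdiv_lt_0_compat|nra]. }
  assert (Hbd : forall x, x = 0 \/ x = 1 -> sg * (0 - y0 x) - (M * layer mu x + K) <= 0).
  { intros x Hx. specialize (Hy0b x). apply Rabs_le_between in Hy0b.
    assert (1 <= layer mu x).
    { unfold layer. destruct Hx; subst x.
      - rewrite Rmult_0_r, Ropp_0, exp_0. pose proof (exp_pos (- (mu * (1 - 0)))). lra.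
      - replace (mu * (1 - 1)) with 0 by ring. rewrite Ropp_0, exp_0.
        pose proof (exp_pos (- (mu * 1))). lra. }
    assert (M * 1 <= M * layer mu x) by (apply Rmult_le_compat_l; lra).
    destruct Hsg; subst sg; lra. }
  set (w := fun x => sg * (u x - y0 x) - (M * layer mu x + K)).
  enough (Hw : forall x, 0 <= x <= 1 -> w x <= 0).
  { intros x Hx. specialize (Hw x Hx). unfold w in Hw. lra. }
  apply (maximum_principle w
    (fun x => sg * (du x - dy0 x) - M * (mu * (exp (- (mu * (1 - x))) - exp (- (mu * x)))))
    (fun x => sg * (ddu x - ddy0 x) - M * (mu ^ 2 * layer mu x))).
  - lra.
  - intros t Ht. apply continuity_pt_minus.
    + apply continuity_pt_scal, continuity_pt_minus; [now apply Huc|apply Hy0c].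
    + apply continuity_pt_plus; [|apply continuity_pt_const; now intros ? ?].
      apply continuity_pt_scal. eapply is_derive_continuity_pt, is_derive_layer.
  - intros t Ht. apply (is_derive_minus (fun x => sg * (u x - y0 x)) (fun x => M * layer mu x + K)).
    + apply is_derive_scal. apply (is_derive_minus u y0); [now apply Hud|now apply Hy0d].
    + rewrite <- (Rplus_0_r (M * _)).
      apply (is_derive_plus (fun x => M * layer mu x) (fun _ => K)).
      * apply is_derive_scal, is_derive_layer.
      * auto_derive; [exact I|ring].
  - intros t Ht. apply (is_derive_minus (fun x => sg * (du x - dy0 x))).
    + apply is_derive_scal. apply (is_derive_minus du dy0); [now apply Hudd|now apply Hy0dd].
    + apply is_derive_scal, is_derive_layer_2.
  - unfold w. rewrite Hu0. apply Hbd. now left.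
  - unfold w. rewrite Hu1. apply Hbd. now right.
  - intros t Ht Hwt. unfold w in Hwt.
    assert (Ht' : 0 <= t <= 1) by lra.
    apply Rmult_lt_reg_l with (eps ^ 2); [nra|].
    rewrite Rmult_0_r.
    replace (eps ^ 2 * (sg * (ddu t - ddy0 t) - M * (mu ^ 2 * layer mu t)))
      with (sg * (eps ^ 2 * ddu t) - eps ^ 2 * (sg * ddy0 t) - (eps ^ 2 * mu ^ 2) * (M * layer mu t))
      by ring.
    rewrite Hode, Hmu2 by assumption.
    assert (Hd : eps ^ 2 * (sg * ddy0 t) <= eps ^ 2 * M).
    { apply Rmult_le_compat_l; [nra|]. specialize (Hddy0b t Ht).
      apply Rabs_le_between in Hddy0b. destruct Hsg; subst sg; lra. }
    pose proof (layer_pos mu t) as HL.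
    assert (HML : 0 < M * layer mu t) by now apply Rmult_lt_0_compat.
    assert (Hf : m * (sg * (u t - y0 t)) <= sg * f t (u t)).
    { specialize (Hy0 t Ht'). destruct Hsg; subst sg.
      - pose proof (reaction_strongly_monotone t (y0 t) (u t) Ht' ltac:(lra)). lra.
      - pose proof (reaction_strongly_monotone t (u t) (y0 t) Ht' ltac:(lra)). lra. }
    assert (m * (M * layer mu t + K) < m * (sg * (u t - y0 t)))
      by (apply Rmult_lt_compat_l; lra).
    lra.
Qed.

Lemma solution_near_reduced (eps : R) (u du ddu : R -> R) :
  0 < eps ->
  (forall x, 0 <= x <= 1 -> continuity_pt u x) ->
  (forall x, 0 < x < 1 -> is_derive u x (du x)) ->
  (forall x, 0 < x < 1 -> is_derive du x (ddu x)) ->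
  (forall x, 0 < x < 1 -> eps ^ 2 * ddu x = f x (u x)) ->
  u 0 = 0 -> u 1 = 0 ->
  forall x, 0 <= x <= 1 ->
    Rabs (u x - y0 x) <= (M + M / m) * (layer (sqrt m / eps) x + eps ^ 2).
Proof.
  intros Heps Huc Hud Hudd Hode Hu0 Hu1 x Hx.
  pose proof (solution_near_reduced_signed 1 eps u du ddu ltac:(now left) Heps Huc Hud Hudd Hode Hu0 Hu1 x Hx).
  pose proof (solution_near_reduced_signed (-1) eps u du ddu ltac:(now right) Heps Huc Hud Hudd Hode Hu0 Hu1 x Hx).
  assert (0 < M / m) by now apply Rdiv_lt_0_compat.
  pose proof (layer_pos (sqrt m / eps) x).
  assert (0 <= M / m * layer (sqrt m / eps) x) by (apply Rmult_le_pos; lra).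
  assert (0 <= M * eps ^ 2) by (apply Rmult_le_pos; nra).
  apply Rabs_le. lra.
Qed.

(* Landau-type interpolation on an interval of length eps/2 around x, over which
   the layer function changes only by the factor exp(sqrt m / 2). *)
Lemma derivative_interpolation (eps A B : R) (v dv ddv : R -> R) :
  0 < eps < 1 -> 0 <= A -> 0 <= B ->
  (forall x, 0 < x < 1 -> is_derive v x (dv x)) ->
  (forall x, 0 < x < 1 -> is_derive dv x (ddv x)) ->
  (forall x, 0 < x < 1 -> Rabs (v x) <= A * (layer (sqrt m / eps) x + eps ^ 2)) ->
  (forall x, 0 < x < 1 -> Rabs (ddv x) <= B * (1 + layer (sqrt m / eps) x / eps ^ 2)) ->
  forall x, 0 < x < 1 ->
    Rabs (dv x) <= (4 * A + B) * exp (sqrt m) * (1 + layer (sqrt m / eps) x / eps).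
Proof.
  intros Heps HA HB Hd Hdd Hv Hddv x Hx.
  set (mu := sqrt m / eps) in *. set (L := layer mu x). set (E := exp (sqrt m)).
  pose proof (sqrt_lt_R0 m Hm) as Hsm.
  assert (Hmu : 0 < mu) by (apply Rdiv_lt_0_compat; lra).
  pose proof (layer_pos mu x : 0 < L) as HL.
  assert (HE : 1 <= E).
  { unfold E. pose proof (exp_ineq1_le (sqrt m)). lra. }
  assert (HLs : forall s, Rabs (s - x) <= eps / 2 -> layer mu s <= E * L).
  { intros s Hs. apply Rle_trans with (exp (mu * (eps / 2)) * L).
    - apply layer_shift; lra.
    - apply Rmult_le_compat_r; [lra|]. apply exp_le. unfold mu.
      replace (sqrt m / eps * (eps / 2)) with (sqrt m / 2) by (field; lra). lra. }
  (* The step is taken towards the farther end point, which keeps s inside (0,1) because eps < 1. *)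
  assert (Hs : exists s, 0 < s < 1 /\ Rabs (s - x) = eps / 2).
  { destruct (Rlt_le_dec x (/ 2)).
    - exists (x + eps / 2). split; [lra|]. rewrite Rabs_pos_eq; lra.
    - exists (x - eps / 2). split; [lra|]. rewrite Rabs_left; lra. }
  destruct Hs as (s & Hs & Hsx).
  (* The interval is merely some open interval around x and s whose closure stays inside (0,1). *)
  destruct (mean_value_two_sided v dv (Rmin x s / 2) ((1 + Rmax x s) / 2) x s) as (c & Hc & Hcx & Ec).
  { unfold Rmin, Rmax; destruct (Rle_dec x s); lra. }
  { unfold Rmin, Rmax; destruct (Rle_dec x s); lra. }
  { intros t Ht; apply Hd. revert Ht. unfold Rmin, Rmax; destruct (Rle_dec x s); lra. }
  { intros t Ht; eapply is_derive_continuity_pt, Hd. revert Ht.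
    unfold Rmin, Rmax; destruct (Rle_dec x s); lra. }
  assert (Hc01 : 0 < c < 1).
  { revert Hc. unfold Rmin, Rmax; destruct (Rle_dec x s); lra. }
  destruct (mean_value_two_sided dv ddv (Rmin x c / 2) ((1 + Rmax x c) / 2) x c) as (e & He & Hex & Ee).
  { unfold Rmin, Rmax; destruct (Rle_dec x c); lra. }
  { unfold Rmin, Rmax; destruct (Rle_dec x c); lra. }
  { intros t Ht; apply Hdd. revert Ht. unfold Rmin, Rmax; destruct (Rle_dec x c); lra. }
  { intros t Ht; eapply is_derive_continuity_pt, Hdd. revert Ht.
    unfold Rmin, Rmax; destruct (Rle_dec x c); lra. }
  assert (He01 : 0 < e < 1).
  { revert He. unfold Rmin, Rmax; destruct (Rle_dec x c); lra. }
  assert (V1 : Rabs (v s) <= A * (E * (L + eps ^ 2))).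
  { apply Rle_trans with (1 := Hv s Hs). apply Rmult_le_compat_l; [lra|].
    pose proof (HLs s ltac:(lra)). assert (0 < eps ^ 2) by nra. nra. }
  assert (V2 : Rabs (v x) <= A * (E * (L + eps ^ 2))).
  { apply Rle_trans with (1 := Hv x Hx). apply Rmult_le_compat_l; [lra|].
    fold L. assert (0 < L + eps ^ 2) by nra. nra. }
  assert (V3 : Rabs (dv c) <= 4 * A * E * (L / eps + eps)).
  { assert (HH : Rabs (dv c) * (eps / 2) <= 2 * (A * (E * (L + eps ^ 2)))).
    { rewrite <- Hsx, <- Rabs_mult, <- Ec.
      unfold Rminus. eapply Rle_trans; [apply Rabs_triang|]. rewrite Rabs_Ropp. lra. }
    apply Rmult_le_reg_r with (eps / 2); [lra|]. apply Rle_trans with (1 := HH).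
    right. field. lra. }
  assert (V4 : Rabs (ddv e * (c - x)) <= B * E * (1 + L / eps ^ 2) * (eps / 2)).
  { rewrite Rabs_mult. apply Rmult_le_compat; try apply Rabs_pos; [|lra].
    apply Rle_trans with (1 := Hddv e He01). rewrite Rmult_assoc.
    apply Rmult_le_compat_l; [lra|].
    pose proof (HLs e ltac:(lra)) as HLe.
    assert (layer mu e / eps ^ 2 <= E * L / eps ^ 2).
    { apply Rmult_le_compat_r; [left; apply Rinv_0_lt_compat; nra|assumption]. }
    unfold Rdiv in *. lra. }
  assert (Hle : 0 < L / eps) by (apply Rdiv_lt_0_compat; lra).
  replace (dv x) with (dv c - ddv e * (c - x)) by lra.
  apply Rle_trans with (Rabs (dv c) + Rabs (ddv e * (c - x))).
  { unfold Rminus at 1. eapply Rle_trans; [apply Rabs_triang|]. rewrite Rabs_Ropp. lra. }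
  replace (B * E * (1 + L / eps ^ 2) * (eps / 2)) with (B * E * ((eps + L / eps) / 2)) in V4
    by (field; lra).
  assert (HAE : 0 <= A * E) by nra. assert (HBE : 0 <= B * E) by nra.
  assert (A * E * (L / eps + eps) <= A * E * (1 + L / eps)) by (apply Rmult_le_compat_l; lra).
  assert (B * E * ((eps + L / eps) / 2) <= B * E * (1 + L / eps)) by (apply Rmult_le_compat_l; lra).
  lra.
Qed.

End Perturbation.

(** Derivative bounds come in an unusual order: u - y0 first, then u'' from eps^2 u'' = f(x, u) -
    f(x, y0), then u' by interpolation, and finally G'' by differentiating f(x, u(x)) twice, which
    needs no third derivative of u. [clamp] makes G continuous at 0 and 1 as a function on the
    line. *)
Lemma solution_estimates : exists (y0 dy0 ddy0 : R -> R) (K : R), 0 < K /\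
  (forall x, 0 <= x <= 1 -> f x (y0 x) = 0) /\
  (forall x, continuity_pt y0 x) /\
  (forall x, 0 < x < 1 ->
     is_derive y0 x (dy0 x) /\ is_derive dy0 x (ddy0 x) /\
     Rabs (dy0 x) <= K /\ Rabs (ddy0 x) <= K) /\
  forall (eps : R) (u : R -> R), 0 < eps < 1 -> is_bvp_solution eps f u ->
    let mu := sqrt m / eps in
    let G := fun t => gam * u t - f (clamp t) (u t) in
    (forall x, 0 <= x <= 1 -> continuity_pt u x /\ continuity_pt G x /\
       Rabs (u x - y0 x) <= K * (layer mu x + eps ^ 2)) /\
    exists du ddu dG ddG : R -> R,
      forall x, 0 < x < 1 ->
        is_derive u x (du x) /\ is_derive du x (ddu x) /\
        G x = gam * u x - eps ^ 2 * ddu x /\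
        is_derive G x (dG x) /\ is_derive dG x (ddG x) /\
        Rabs (ddG x) <= K * (1 + layer mu x / eps ^ 2).
Proof.
  destruct reduced_solution_C2
    as (y0 & dy0 & ddy0 & M & HM & Hy0 & Hy0c & Hy0d & Hy0dd & Hy0b & Hdy0b & Hddy0b).
  assert (Hmg : m <= gam).
  { pose proof (Hlo 0 0 ltac:(lra)). pose proof (Hhi 0 0 ltac:(lra)). lra. }
  set (K1 := M + M / m).
  assert (HMm : 0 < M / m) by now apply Rdiv_lt_0_compat.
  assert (HK1 : 0 < K1) by (unfold K1; lra).
  (* A bound for |u|, proved below as [Hub]: |u - y0| <= K1 (E + eps^2) with E <= 2 and eps < 1. *)
  destruct (partials_bounded (3 * K1 + M)) as (B & HB & Hpart).
  set (K2 := gam * K1).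
  assert (HK2 : 0 < K2) by (unfold K2; nra).
  set (K3 := (4 * K1 + (K2 + M)) * exp (sqrt m) + M).
  pose proof (exp_pos (sqrt m)) as Hexp.
  assert (HK3 : 0 < K3) by (unfold K3; nra).
  set (K4 := gam * K2 + (B + B * K3) + (B * K3 + 4 * (B * K3 ^ 2)) + gam * K2).
  assert (HK4 : 0 < K4).
  { unfold K4. assert (0 < B * K3) by nra. assert (0 < B * K3 ^ 2) by nra.
    assert (0 < gam * K2) by nra. lra. }
  exists y0, dy0, ddy0, (M + K1 + K4).
  split; [lra|]. split; [exact Hy0|]. split; [exact Hy0c|]. split.
  { intros x Hx. specialize (Hdy0b x Hx). specialize (Hddy0b x Hx).
    split; [now apply Hy0d|]. split; [now apply Hy0dd|]. lra. }
  intros eps u Heps (Huc & du & ddu & Hu & Hu0 & Hu1) mu G.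
  assert (Huc' : forall x, 0 <= x <= 1 -> continuity_pt u x).
  { intros x Hx. apply continuity_pt_filterlim. now apply Huc. }
  assert (Hud : forall x, 0 < x < 1 -> is_derive u x (du x)) by (intros; now apply Hu).
  assert (Hudd : forall x, 0 < x < 1 -> is_derive du x (ddu x)) by (intros; now apply Hu).
  assert (Hode : forall x, 0 < x < 1 -> eps ^ 2 * ddu x = f x (u x)) by (intros; now apply Hu).
  assert (Hnear : forall x, 0 <= x <= 1 -> Rabs (u x - y0 x) <= K1 * (layer mu x + eps ^ 2)).
  { apply (solution_near_reduced y0 dy0 ddy0 M HM Hy0 Hy0c Hy0d Hy0dd Hy0b Hddy0b eps u du ddu);
      try assumption; lra. }
  assert (Hmu : 0 < mu) by (apply Rdiv_lt_0_compat; [now apply sqrt_lt_R0|lra]).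
  split.
  { intros x Hx. split; [now apply Huc'|]. split.
    - unfold G. apply continuity_pt_minus; [now apply continuity_pt_scal, Huc'|].
      apply continuity_pt_filterlim.
      apply (continuous_comp_2 (fun t : R => t) u (fun a b => f (clamp a) b) x).
      + apply continuous_id.
      + now apply Huc.
      + apply (cont_strip_clamp f (fun x y Hx => proj1 (Hcont x y Hx)) x (u x)).
    - apply Rle_trans with (1 := Hnear x Hx). pose proof (layer_pos mu x).
      apply Rmult_le_compat_r; [nra|lra]. }
  assert (Hu2 : forall x, 0 < x < 1 -> Rabs (ddu x) <= K2 * (1 + layer mu x / eps ^ 2)).
  { intros x Hx. assert (Hx' : 0 <= x <= 1) by lra.
    apply Rmult_le_reg_l with (eps ^ 2); [nra|].
    rewrite <- (Rabs_pos_eq (eps ^ 2)) at 1 by nra.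
    rewrite <- Rabs_mult, Hode by assumption.
    replace (f x (u x)) with (f x (u x) - f x (y0 x)) by (rewrite Hy0 by assumption; ring).
    apply Rle_trans with (1 := reaction_lipschitz x _ _ Hx').
    replace (eps ^ 2 * (K2 * (1 + layer mu x / eps ^ 2)))
      with (gam * (K1 * (layer mu x + eps ^ 2))) by (unfold K2; field; lra).
    apply Rmult_le_compat_l; [lra|]. now apply Hnear. }
  assert (Hu1b : forall x, 0 < x < 1 -> Rabs (du x) <= K3 * (1 + layer mu x / eps)).
  { intros x Hx.
    assert (Hle : 0 < layer mu x / eps) by (apply Rdiv_lt_0_compat; [apply layer_pos|lra]).
    assert (Hv : Rabs (du x - dy0 x)
                 <= (4 * K1 + (K2 + M)) * exp (sqrt m) * (1 + layer mu x / eps)).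
    { apply (derivative_interpolation eps K1 (K2 + M) (fun x => u x - y0 x)
        (fun x => du x - dy0 x) (fun x => ddu x - ddy0 x)); try lra.
      - intros t Ht. apply (is_derive_minus u y0); [now apply Hud|now apply Hy0d].
      - intros t Ht. apply (is_derive_minus du dy0); [now apply Hudd|now apply Hy0dd].
      - intros t Ht. apply Hnear. lra.
      - intros t Ht. unfold Rminus. eapply Rle_trans; [apply Rabs_triang|].
        rewrite Rabs_Ropp. specialize (Hu2 t Ht). specialize (Hddy0b t Ht).
        fold mu. assert (0 < layer mu t / eps ^ 2)
          by (apply Rdiv_lt_0_compat; [apply layer_pos|nra]).
        nra. }
    specialize (Hdy0b x Hx).
    replace (du x) with ((du x - dy0 x) + dy0 x) by ring.
    eapply Rle_trans; [apply Rabs_triang|]. unfold K3.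
    rewrite Rmult_plus_distr_r. nra. }
  assert (Hub : forall x, 0 <= x <= 1 -> Rabs (u x) <= 3 * K1 + M).
  { intros x Hx. specialize (Hnear x Hx). specialize (Hy0b x).
    pose proof (layer_le_2 mu x ltac:(lra) Hx).
    assert (K1 * (layer mu x + eps ^ 2) <= K1 * 3) by (apply Rmult_le_compat_l; nra).
    replace (u x) with ((u x - y0 x) + y0 x) by ring.
    eapply Rle_trans; [apply Rabs_triang|]. lra. }
  exists du, ddu, (fun x => gam * du x - (fx x (u x) + fy x (u x) * du x)),
    (fun x => gam * ddu x - ((fxx x (u x) + fxy x (u x) * du x)
       + ((fyx x (u x) + fyy x (u x) * du x) * du x + fy x (u x) * ddu x))).
  intros x Hx. assert (Hx' : 0 <= x <= 1) by lra.
  split; [now apply Hud|]. split; [now apply Hudd|]. split.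
  { unfold G. rewrite clamp_id by lra. rewrite Hode by assumption. reflexivity. }
  split; [|split].
  - unfold G. apply (is_derive_minus (fun t => gam * u t)).
    + apply is_derive_scal. now apply Hud.
    + apply (is_derive_ext_loc (fun t => f t (u t))).
      * assert (Hd : 0 < Rmin x (1 - x)) by (apply Rmin_glb_lt; lra).
        exists (mkposreal _ Hd). intros t Ht. change (Rabs (t - x) < Rmin x (1 - x)) in Ht.
        apply Rabs_def2 in Ht. pose proof (Rmin_l x (1 - x)). pose proof (Rmin_r x (1 - x)).
        rewrite clamp_id by lra. reflexivity.
      * apply (chain_rule_strip f fx fy u); try assumption.
        -- intros; now apply Hdx.
        -- now apply Hdy.
        -- now apply Hcont.
        -- now apply Hud.
  - apply (is_derive_minus (fun t => gam * du t)).
    + apply is_derive_scal. now apply Hudd.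
    + apply (is_derive_plus (fun t => fx t (u t)) (fun t => fy t (u t) * du t)).
      * apply (chain_rule_strip fx fxx fxy u); try assumption.
        -- intros; now apply Hdx.
        -- now apply Hdy.
        -- now apply Hcont.
        -- now apply Hud.
      * apply (is_derive_mult (fun t => fy t (u t)) du).
        -- apply (chain_rule_strip fy fyx fyy u); try assumption.
           ++ intros; now apply Hdx.
           ++ now apply Hdy.
           ++ now apply Hcont.
           ++ now apply Hud.
        -- now apply Hudd.
        -- intros; apply Rmult_comm.
  - destruct (Hpart x (u x) Hx' (Hub x Hx')) as (_ & B1 & B2 & B3 & B4).
    specialize (Hu2 x Hx). specialize (Hu1b x Hx).
    pose proof (Hlo x (u x) Hx') as F1. pose proof (Hhi x (u x) Hx') as F2.
    set (L := layer mu x) in *. pose proof (layer_pos mu x : 0 < L) as HL.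
    pose proof (layer_le_2 mu x ltac:(lra) Hx' : L <= 2) as HL2.
    set (P := L / eps ^ 2) in *. set (Q := L / eps) in *.
    assert (HQ : 0 < Q) by (apply Rdiv_lt_0_compat; lra).
    assert (HPQ : P * eps = Q) by (unfold P, Q; field; lra).
    assert (HP : 0 < P) by (apply Rdiv_lt_0_compat; nra).
    assert (HQP : Q <= P) by nra.
    (* The quadratic term fyy u'^2 is no larger in order than u'', since E^2 <= 2 E. *)
    assert (HQ2 : Q ^ 2 <= 2 * P).
    { replace (Q ^ 2) with (L * P) by (unfold P, Q; field; lra). nra. }
    assert (HQ3 : (1 + Q) ^ 2 <= 4 * (1 + P)) by nra.
    set (p := Rabs (du x)) in *. assert (Hp : 0 <= p) by apply Rabs_pos.
    assert (Hp1 : p <= K3 * (1 + P)) by nra.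
    assert (Hp2 : p ^ 2 <= 4 * (K3 ^ 2 * (1 + P))).
    { apply Rle_trans with ((K3 * (1 + Q)) ^ 2); [apply pow_incr; lra|].
      rewrite Rpow_mult_distr. assert (0 < K3 ^ 2) by nra. nra. }
    assert (T1 : Rabs (gam * ddu x) <= gam * (K2 * (1 + P))).
    { rewrite Rabs_mult, (Rabs_pos_eq gam) by lra. apply Rmult_le_compat_l; lra. }
    assert (T2 : Rabs (fxx x (u x) + fxy x (u x) * du x) <= B + B * p).
    { eapply Rle_trans; [apply Rabs_triang|]. rewrite Rabs_mult.
      assert (Rabs (fxy x (u x)) * p <= B * p) by (apply Rmult_le_compat_r; lra).
      unfold p in *; lra. }
    assert (T3 : Rabs ((fyx x (u x) + fyy x (u x) * du x) * du x) <= B * p + B * p ^ 2).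
    { rewrite Rabs_mult. replace (B * p + B * p ^ 2) with ((B + B * p) * p) by ring.
      apply Rmult_le_compat_r; [exact Hp|].
      eapply Rle_trans; [apply Rabs_triang|]. rewrite Rabs_mult.
      assert (Rabs (fyy x (u x)) * p <= B * p) by (apply Rmult_le_compat_r; lra).
      unfold p in *; lra. }
    assert (T4 : Rabs (fy x (u x) * ddu x) <= gam * (K2 * (1 + P))).
    { rewrite Rabs_mult, (Rabs_pos_eq (fy _ _)) by lra.
      apply Rmult_le_compat; try apply Rabs_pos; lra. }
    assert (S1 : B * p <= B * K3 * (1 + P)).
    { rewrite Rmult_assoc. apply Rmult_le_compat_l; lra. }
    assert (S2 : B * p ^ 2 <= 4 * (B * K3 ^ 2) * (1 + P)).
    { replace (4 * (B * K3 ^ 2) * (1 + P)) with (B * (4 * (K3 ^ 2 * (1 + P)))) by ring.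
      apply Rmult_le_compat_l; lra. }
    assert (S3 : B <= B * (1 + P)) by nra.
    apply Rle_trans with (K4 * (1 + P)).
    + unfold K4. apply Rabs_le_between in T1, T2, T3, T4. apply Rabs_le. lra.
    + apply Rmult_le_compat_r; lra.
Qed.

End Reaction.

(** * The mesh *)

(** Only t = 1/2 needs a computation: both sides then use the left branch, and p is the coefficient
    for which its value is 1/2. *)
Lemma phi_symmetric (lm t : R) : phi lm (1 - t) = 1 - phi lm t.
Proof.
  destruct (Req_dec t (/ 2)) as [->|Ht].
  - replace (1 - / 2) with (/ 2) by lra. unfold phi, phi_half, pcoef, q.
    destruct (Rle_dec (/ 2) (/ 2)); [|lra]. destruct (Rle_dec (/ 2) (1 / 4)); [lra|].
    field.
  - unfold phi. destruct (Rle_dec (1 - t) (/ 2)), (Rle_dec t (/ 2)); try lra.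
    replace (1 - (1 - t)) with t by ring. reflexivity.
Qed.

Section Mesh.

Variables (eps m : R) (n : nat).
Let N := (4 * n)%nat.
Let lm := lam eps m N.
Let X := mesh eps m N.
Let h := hstep eps m N.
Let rn := INR n.
Hypothesis Hn : (0 < n)%nat.
Hypothesis Hlm : 0 < lm <= 1 / 4.

Lemma mesh_quarter_pos : 0 < rn.
Proof. now apply lt_0_INR. Qed.

Lemma mesh_quarter_ge_1 : 1 <= rn.
Proof. apply (le_INR 1 n). lia. Qed.

Lemma mesh_size : INR N = 4 * rn.
Proof. unfold N. rewrite mult_INR. simpl. unfold rn. ring. Qed.

Lemma mesh_layer (i : nat) : (i <= n)%nat -> X i = lm / rn * INR i.
Proof.
  intros Hi. pose proof mesh_quarter_pos. pose proof (le_INR _ _ Hi) as Hin. pose proof (pos_INR i).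
  fold rn in Hin. unfold X, mesh. fold lm. rewrite mesh_size.
  assert (Ht : INR i / (4 * rn) <= 1 / 4).
  { apply Rmult_le_reg_r with (4 * rn); [lra|].
    unfold Rdiv at 1. rewrite Rmult_assoc, Rinv_l by lra. lra. }
  unfold phi, phi_half, q. destruct (Rle_dec _ (/ 2)); [|lra].
  destruct (Rle_dec _ (1 / 4)); [|lra]. field. lra.
Qed.

Lemma mesh_middle (i : nat) : (n <= i <= 2 * n)%nat ->
  X i = (1 - 4 * lm) / 2 * ((INR i - rn) / rn) ^ 3 + lm / rn * INR i.
Proof.
  intros [H1 H2]. pose proof mesh_quarter_pos.
  destruct (Nat.eq_dec i n) as [->|Hne].
  { rewrite mesh_layer by lia. fold rn. field. lra. }
  apply le_INR in H2. rewrite mult_INR in H2. simpl in H2.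
  assert (H3 : INR n < INR i) by (apply lt_INR; lia). fold rn in H2, H3.
  unfold X, mesh. fold lm. rewrite mesh_size.
  assert (Ht : 1 / 4 < INR i / (4 * rn) <= / 2).
  { split.
    - apply Rmult_lt_reg_r with (4 * rn); [lra|].
      unfold Rdiv at 2. rewrite Rmult_assoc, Rinv_l by lra. lra.
    - apply Rmult_le_reg_r with (4 * rn); [lra|].
      unfold Rdiv. rewrite Rmult_assoc, Rinv_l by lra. lra. }
  unfold phi, phi_half, pcoef, q. destruct (Rle_dec _ (/ 2)); [|lra].
  destruct (Rle_dec _ (1 / 4)); [lra|]. field. lra.
Qed.

Lemma mesh_symmetric (i : nat) : (i <= N)%nat -> X (N - i) = 1 - X i.
Proof.
  intros Hi. unfold X, mesh. rewrite minus_INR by assumption.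
  pose proof mesh_size. pose proof mesh_quarter_pos.
  replace ((INR N - INR i) / INR N) with (1 - INR i / INR N) by (field; lra).
  apply phi_symmetric.
Qed.

Lemma mesh_0 : X 0 = 0.
Proof. rewrite mesh_layer by lia. simpl. ring. Qed.

Lemma mesh_N : X N = 1.
Proof.
  replace N with (N - 0)%nat at 1 by lia. rewrite mesh_symmetric by lia. rewrite mesh_0. ring.
Qed.

Lemma hstep_symmetric (i : nat) : (i < N)%nat -> h (N - 1 - i) = h i.
Proof.
  intros Hi. unfold h, hstep. fold X.
  replace (S (N - 1 - i)) with (N - i)%nat by lia.
  replace (N - 1 - i)%nat with (N - S i)%nat by lia.
  rewrite !mesh_symmetric by lia. ring.
Qed.

Lemma hstep_layer (i : nat) : (i < n \/ 3 * n <= i < N)%nat -> h i = lm / rn.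
Proof.
  assert (Hl : forall i, (i < n)%nat -> h i = lm / rn).
  { intros k Hk. unfold h, hstep. fold X. rewrite !mesh_layer by lia. rewrite S_INR. ring. }
  intros [H|H]; [now apply Hl|].
  rewrite <- hstep_symmetric by lia. apply Hl. unfold N in *. lia.
Qed.

Lemma hstep_middle (i : nat) : (n <= i < 2 * n)%nat ->
  h i = (1 - 4 * lm) / 2 * ((3 * (INR i - rn) ^ 2 + 3 * (INR i - rn) + 1) / rn ^ 3) + lm / rn.
Proof.
  intros Hi. pose proof mesh_quarter_pos. unfold h, hstep. fold X.
  rewrite !mesh_middle by lia. rewrite S_INR. field. lra.
Qed.

Lemma hstep_bounds (i : nat) : (i < N)%nat -> lm / rn <= h i <= 8 / INR N.
Proof.
  pose proof mesh_quarter_pos as Hp. rewrite mesh_size.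
  assert (Hl : lm / rn <= 8 / (4 * rn)).
  { unfold Rdiv. rewrite Rinv_mult. assert (0 < / rn) by now apply Rinv_0_lt_compat. nra. }
  assert (Hhalf : forall i, (i < 2 * n)%nat -> lm / rn <= h i <= 8 / (4 * rn)).
  { intros k Hk. destruct (Nat.lt_ge_cases k n) as [H|H].
    - rewrite hstep_layer by lia. lra.
    - rewrite hstep_middle by lia.
      assert (K0 : 0 <= INR k - rn) by (apply le_INR in H; fold rn in H; lra).
      assert (K1 : INR k - rn <= rn - 1).
      { assert (HH : (S k <= 2 * n)%nat) by lia. apply le_INR in HH.
        rewrite S_INR, mult_INR in HH. simpl in HH. fold rn in HH. lra. }
      set (y := INR k - rn) in *.
      assert (Hr3 : 0 < rn ^ 3) by now apply pow_lt.
      (* The numerator is (y + 1)^3 - y^3 with 0 <= y <= rn - 1. *)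
      assert (Y : 0 <= (3 * y ^ 2 + 3 * y + 1) / rn ^ 3 <= 3 / rn).
      { split; [apply Rdiv_le_0_compat; nra|].
        apply Rmult_le_reg_r with (rn ^ 3); [assumption|].
        unfold Rdiv at 1. rewrite Rmult_assoc, Rinv_l, Rmult_1_r by lra.
        replace (3 / rn * rn ^ 3) with (3 * rn ^ 2) by (field; lra). nra. }
      set (Z := (3 * y ^ 2 + 3 * y + 1) / rn ^ 3) in *.
      assert (0 < / rn) by now apply Rinv_0_lt_compat.
      replace (8 / (4 * rn)) with (2 * / rn) by (field; lra). unfold Rdiv in *. nra. }
  intros Hi. destruct (Nat.lt_ge_cases i (2 * n)) as [H|H]; [now apply Hhalf|].
  rewrite <- hstep_symmetric by assumption. apply Hhalf. unfold N in *. lia.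
Qed.

(** The linear part of the mesh function cancels and a second difference of a cube remains. Because
    the cubic vanishes to third order at t = q, the step changes by O(N^-2) at the transition point
    as well; a piecewise uniform mesh could jump there by O(1/N). *)
Lemma hstep_variation (i : nat) : (n <= S i <= 3 * n)%nat ->
  Rabs (h i - h (S i)) <= 48 / INR N ^ 2.
Proof.
  pose proof mesh_quarter_ge_1 as Hp. rewrite mesh_size.
  replace (48 / (4 * rn) ^ 2) with (3 / rn ^ 2) by (field; lra).
  assert (Hr3 : 0 < rn ^ 3) by (apply pow_lt; lra).
  assert (Hhalf : forall i, (n <= S i < 2 * n)%nat -> Rabs (h i - h (S i)) <= 3 / rn ^ 2).
  { intros k Hk.
    assert (E : exists c, 0 <= c <= 6 * rn /\ h (S k) - h k = (1 - 4 * lm) / 2 * (c / rn ^ 3)).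
    { destruct (Nat.eq_dec (S k) n) as [H|H].
      - exists 1. split; [lra|]. rewrite hstep_middle by lia. rewrite hstep_layer by lia.
        rewrite H. fold rn. field. lra.
      - exists (6 * (INR (S k) - rn)). split.
        + destruct Hk as [H1 H2]. assert (H3 : (S k <= 2 * n)%nat) by lia.
          apply le_INR in H1, H3.
          rewrite mult_INR in H3. simpl (INR 2) in H3. fold rn in H1, H3. lra.
        + rewrite !hstep_middle by lia. rewrite S_INR. field. lra. }
    destruct E as (c & Hc & E).
    rewrite Rabs_minus_sym, E.
    assert (C : 0 <= c / rn ^ 3 <= 6 / rn ^ 2).
    { split; [apply Rdiv_le_0_compat; lra|].
      apply Rmult_le_reg_r with (rn ^ 3); [assumption|].
      unfold Rdiv at 1. rewrite Rmult_assoc, Rinv_l, Rmult_1_r by lra.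
      replace (6 / rn ^ 2 * rn ^ 3) with (6 * rn) by (field; lra). lra. }
    set (Z := c / rn ^ 3) in *.
    replace (6 / rn ^ 2) with (2 * (3 / rn ^ 2)) in C by (field; lra).
    rewrite Rabs_pos_eq by nra. nra. }
  intros Hi. destruct (Nat.lt_trichotomy (S i) (2 * n)) as [H|[H|H]].
  - apply Hhalf. lia.
  - rewrite <- (hstep_symmetric i) by (unfold N; lia).
    replace (N - 1 - i)%nat with (S i) by (unfold N; lia).
    rewrite Rminus_diag, Rabs_R0. apply Rdiv_le_0_compat; [lra|nra].
  - rewrite <- (hstep_symmetric i), <- (hstep_symmetric (S i)) by (unfold N; lia).
    replace (N - 1 - i)%nat with (S (N - 1 - S i)) by (unfold N; lia).
    rewrite Rabs_minus_sym. apply Hhalf. unfold N. lia.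
Qed.

Lemma mesh_monotone (i j : nat) : (i <= j <= N)%nat -> X i <= X j.
Proof.
  intros [Hij HjN]. induction Hij as [|j Hij IH]; [lra|].
  specialize (IH ltac:(lia)). pose proof (hstep_bounds j ltac:(lia)) as [Hb _].
  assert (0 < lm / rn) by (apply Rdiv_lt_0_compat; [lra|exact mesh_quarter_pos]).
  unfold h, hstep in Hb. fold X in Hb. lra.
Qed.

Lemma mesh_range (i : nat) : (i <= N)%nat -> 0 <= X i <= 1.
Proof.
  intros Hi. rewrite <- mesh_0, <- mesh_N. split; apply mesh_monotone; lia.
Qed.

(** The stencil of node n reaches node n - 1, one layer step short of lm; symmetrically for node 3
    n. *)
Lemma mesh_outside_layers (i : nat) : (n <= S i <= 3 * n)%nat ->
  lm - lm / rn <= X i /\ X (S (S i)) <= 1 - (lm - lm / rn).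
Proof.
  intros Hi. pose proof mesh_quarter_pos.
  assert (E : X (n - 1) = lm - lm / rn).
  { rewrite mesh_layer by lia. rewrite minus_INR by lia. fold rn. simpl. field. lra. }
  rewrite <- E, <- mesh_symmetric by (unfold N; lia).
  split; apply mesh_monotone; unfold N; lia.
Qed.

End Mesh.

(** * Truncation errors *)

Lemma mesh_size_ge_4 (n : nat) : (0 < n)%nat -> 4 <= INR (4 * n).
Proof.
  intros Hn. rewrite mult_INR. simpl. assert (1 <= INR n) by (apply (le_INR 1 n); lia). lra.
Qed.

Lemma log_mesh_size (n : nat) : (0 < n)%nat -> 1 <= ln (INR (4 * n)) <= INR (4 * n).
Proof.
  intros Hn. pose proof (mesh_size_ge_4 n Hn). split.
  - rewrite <- (ln_exp 1). pose proof exp_le_3. pose proof (exp_pos 1).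
    left. apply ln_increasing; lra.
  - pose proof (exp_ineq1_le (ln (INR (4 * n)))) as H1. rewrite exp_ln in H1 by lra. lra.
Qed.

Section Truncation.

Variables (eps m gam K C0 : R) (n : nat).
Let N := (4 * n)%nat.
Let lm := lam eps m N.
Let X := mesh eps m N.
Let h := hstep eps m N.
Let b := beta gam eps.
Let mu := sqrt m / eps.
Let l := ln (INR N).
Hypothesis Hn : (0 < n)%nat.
Hypothesis Hlm : lm <= 1 / 4.
Hypothesis Heps : 0 < eps < 1.
Hypothesis HepsN : eps <= C0 / INR N.
Hypothesis Hm : 0 < m.
Hypothesis Hgam : 0 < gam.
Hypothesis HK : 0 < K.

(** Hence exp (- mu lm) = N^-2: the factor 2 in the transition point brings the layer function down
    to the target accuracy there. *)
Lemma transition_point : mu * lm = 2 * l.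
Proof.
  pose proof (sqrt_lt_R0 m Hm). unfold mu, lm, lam. fold l. field. lra.
Qed.

Lemma transition_point_pos : 0 < lm.
Proof.
  pose proof (sqrt_lt_R0 m Hm). pose proof (log_mesh_size n Hn : 1 <= l <= INR N). unfold lm, lam. fold l.
  apply Rmult_lt_0_compat; [|lra]. apply Rdiv_lt_0_compat; lra.
Qed.

Lemma layer_step : lm / INR n = 8 * eps / sqrt m * (l / INR N).
Proof.
  pose proof (sqrt_lt_R0 m Hm). pose proof (mesh_size_ge_4 n Hn : 4 <= INR N).
  assert (E : INR N = 4 * INR n) by (unfold N; rewrite mult_INR; simpl; ring).
  unfold lm, lam. fold l. rewrite E. field. lra.
Qed.

Lemma layer_step_pos : 0 < lm / INR n.
Proof. apply Rdiv_lt_0_compat; [apply transition_point_pos|now apply lt_0_INR]. Qed.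

(** The origin of every exp 8 below: the layer function changes at most by this factor over one
    layer step. *)
Lemma layer_step_scaled : mu * (lm / INR n) <= 8.
Proof.
  pose proof (sqrt_lt_R0 m Hm). pose proof (mesh_size_ge_4 n Hn : 4 <= INR N). pose proof (log_mesh_size n Hn : 1 <= l <= INR N).
  rewrite layer_step. unfold mu.
  replace (sqrt m / eps * (8 * eps / sqrt m * (l / INR N))) with (8 * (l / INR N))
    by (field; lra).
  assert (l / INR N <= 1).
  { apply Rmult_le_reg_r with (INR N); [lra|].
    unfold Rdiv. rewrite Rmult_assoc, Rinv_l by lra. lra. }
  lra.
Qed.

Lemma hstep_pos (i : nat) : (i < N)%nat -> 0 < h i.
Proof.
  intros Hi.
  assert (Hlm' : 0 < lm <= 1 / 4) by (split; [apply transition_point_pos|exact Hlm]).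
  apply Rlt_le_trans with (1 := layer_step_pos).
  exact (proj1 (hstep_bounds eps m n Hn Hlm' i Hi)).
Qed.

Lemma scaled_step_pos (i : nat) : (i < N)%nat -> 0 < b * h i.
Proof.
  intros Hi. apply Rmult_lt_0_compat; [|now apply hstep_pos].
  apply Rdiv_lt_0_compat; [now apply sqrt_lt_R0|lra].
Qed.

Variables (u du ddu G dG ddG : R -> R).
Hypothesis HuG : forall x, 0 <= x <= 1 -> continuity_pt u x /\ continuity_pt G x.
Hypothesis Hder : forall x, 0 < x < 1 ->
  is_derive u x (du x) /\ is_derive du x (ddu x) /\
  G x = gam * u x - eps ^ 2 * ddu x /\
  is_derive G x (dG x) /\ is_derive dG x (ddG x) /\
  Rabs (ddG x) <= K * (1 + layer mu x / eps ^ 2).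

(** The residual of u in the form of the scheme given by [scheme_fitted_form], indexed by the left
    neighbour: it belongs to node S i. *)
Definition truncation (i : nat) : R :=
  gam * fitted (/ sinh (b * h i)) (/ sinh (b * h (S i)))
          (tanh_half (b * h i)) (tanh_half (b * h (S i)))
          (u (X i)) (u (X (S i))) (u (X (S (S i))))
    / (tanh_half (b * h i) + tanh_half (b * h (S i)))
  - (G (X i) + 2 * G (X (S i)) + G (X (S (S i)))) / 4.

Lemma truncation_bound (i : nat) (c0 c1 eta : R) :
  (S (S i) <= N)%nat ->
  (forall t, X i <= t <= X (S (S i)) -> Rabs (G t - (c0 + c1 * (t - X (S i)))) <= eta) ->
  Rabs (truncation i) <= 2 * eta + 2 * Rabs c1 * Rabs (h i - h (S i)).
Proof.
  intros Hi Hb.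
  assert (Hlm' : 0 < lm <= 1 / 4) by (split; [apply transition_point_pos|exact Hlm]).
  pose proof (hstep_pos i ltac:(lia)) as H1. pose proof (hstep_pos (S i) ltac:(lia)) as H2.
  pose proof (mesh_range eps m n Hn Hlm' i ltac:(fold N; lia)) as R1.
  pose proof (mesh_range eps m n Hn Hlm' (S (S i)) ltac:(fold N; lia)) as R2.
  fold N in R1, R2. fold X in R1, R2.
  unfold truncation.
  replace (X i) with (X (S i) - h i) in * by (unfold h, hstep, X; ring).
  replace (X (S (S i))) with (X (S i) + h (S i)) in * by (unfold h, hstep, X; ring).
  apply (fitted_truncation u du ddu (X (S i)) (h i) (h (S i)) eps gam) with (c0 := c0);
    try assumption; try lra.
  - intros t Ht. apply HuG. lra.
  - intros t Ht. apply Hder. lra.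
  - intros t Ht. apply Hder. lra.
  - intros t Ht. apply Hder. lra.
Qed.

(** Both steps equal L, so the term with h_i - h_{i+1} disappears, and the tangent of G at the node
    gives eta = K' L^2. There L^2 <= N^-2 and L^2 / eps^2 = (64 / m) (l / N)^2, which absorbs the
    eps^-2 in G''. *)
Lemma truncation_layer (i : nat) :
  (S (S i) <= N)%nat -> (S i < n \/ 3 * n < S i)%nat ->
  Rabs (truncation i)
    <= 2 * K * (/ INR N ^ 2 + 64 * exp 8 / m * (l / INR N) ^ 2 * layer mu (X (S i))).
Proof.
  intros Hi Hlay. pose proof (mesh_size_ge_4 n Hn : 4 <= INR N) as HN4.
  assert (Hlm' : 0 < lm <= 1 / 4) by (split; [apply transition_point_pos|exact Hlm]).
  set (L := lm / INR n).
  assert (E1 : h i = L).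
  { apply (hstep_layer eps m n Hn). unfold N in *. lia. }
  assert (E2 : h (S i) = L).
  { apply (hstep_layer eps m n Hn). unfold N in *. lia. }
  assert (HL : 0 < L) by apply layer_step_pos.
  pose proof (mesh_range eps m n Hn Hlm' i ltac:(fold N; lia)) as R1.
  pose proof (mesh_range eps m n Hn Hlm' (S (S i)) ltac:(fold N; lia)) as R2.
  fold N in R1, R2. fold X in R1, R2.
  assert (X0 : X i = X (S i) - L) by (rewrite <- E1; unfold h, hstep, X; ring).
  assert (X2 : X (S (S i)) = X (S i) + L) by (rewrite <- E2; unfold h, hstep, X; ring).
  set (x := X (S i)) in *. set (Lx := layer mu x).
  pose proof (layer_pos mu x : 0 < Lx) as HLx.
  assert (Hmu : 0 < mu) by (apply Rdiv_lt_0_compat; [now apply sqrt_lt_R0|lra]).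
  set (K' := K * (1 + exp 8 * Lx / eps ^ 2)).
  pose proof (exp_pos 8) as He8.
  assert (HK' : 0 < K').
  { unfold K'. apply Rmult_lt_0_compat; [assumption|].
    assert (0 < exp 8 * Lx / eps ^ 2) by (apply Rdiv_lt_0_compat; nra). lra. }
  assert (HddG : forall t, x - L < t < x + L -> Rabs (ddG t) <= K').
  { intros t Ht. assert (Ht' : 0 < t < 1) by lra.
    destruct (Hder t Ht') as (_ & _ & _ & _ & _ & Hb).
    apply Rle_trans with (1 := Hb). unfold K'. apply Rmult_le_compat_l; [lra|].
    apply Rplus_le_compat_l. apply Rmult_le_compat_r; [left; apply Rinv_0_lt_compat; nra|].
    apply Rle_trans with (exp (mu * L) * Lx).
    - apply layer_shift; [lra|]. apply Rabs_le; lra.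
    - apply Rmult_le_compat_r; [lra|]. apply exp_le. apply layer_step_scaled. }
  assert (HT : Rabs (truncation i) <= 2 * (K' * L ^ 2) + 2 * Rabs (dG x) * Rabs (h i - h (S i))).
  { apply (truncation_bound i (G x) (dG x) (K' * L ^ 2) Hi). fold x.
    intros t Ht. replace (G t - (G x + dG x * (t - x))) with (G t - G x - dG x * (t - x)) by ring.
    apply Rle_trans with (K' * (t - x) ^ 2).
    - apply (taylor_first_order G dG ddG (x - L) (x + L)); try lra.
      + intros s Hs. apply HuG. lra.
      + intros s Hs. apply Hder. lra.
      + intros s Hs. apply Hder. lra.
      + exact HddG.
    - apply Rmult_le_compat_l; [lra|].
      rewrite <- (pow2_abs (t - x)). apply pow_incr. split; [apply Rabs_pos|].
      apply Rabs_le. lra. }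
  rewrite E1, E2, Rminus_diag, Rabs_R0, Rmult_0_r, Rplus_0_r in HT.
  apply Rle_trans with (1 := HT).
  assert (Hsm : sqrt m * sqrt m = m) by (apply sqrt_sqrt; lra).
  pose proof (sqrt_lt_R0 m Hm) as Hsm0.
  assert (HL2 : L ^ 2 / eps ^ 2 = 64 / m * (l / INR N) ^ 2).
  { unfold L. rewrite layer_step.
    replace (64 / m) with (64 / (sqrt m * sqrt m)) by now rewrite Hsm.
    field. lra. }
  assert (HL1 : L ^ 2 <= / INR N ^ 2).
  { rewrite <- pow_inv. apply pow_incr. split; [lra|].
    unfold L. replace (INR N) with (4 * INR n) by (unfold N; rewrite mult_INR; simpl; ring).
    rewrite Rinv_mult. assert (0 < / INR n) by (apply Rinv_0_lt_compat; now apply lt_0_INR).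
    unfold Rdiv. nra. }
  replace (2 * (K' * L ^ 2)) with (2 * K * (L ^ 2 + exp 8 * Lx * (L ^ 2 / eps ^ 2)))
    by (unfold K'; field; lra).
  rewrite HL2. apply Rmult_le_compat_l; [lra|].
  apply Rplus_le_compat; [exact HL1|]. right. field. split; lra.
Qed.

Variables (y0 dy0 ddy0 : R -> R).
Hypothesis Hy0c : forall x, continuity_pt y0 x.
Hypothesis Hy0d : forall x, 0 < x < 1 ->
     is_derive y0 x (dy0 x) /\ is_derive dy0 x (ddy0 x) /\
     Rabs (dy0 x) <= K /\ Rabs (ddy0 x) <= K.
Hypothesis Hnear : forall x, 0 <= x <= 1 ->
  Rabs (G x - gam * y0 x) <= 2 * gam * (K * (layer mu x + eps ^ 2)).

(** Expanding G is useless here: its second derivative may be of size E / eps^2 while the steps do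
    not shrink with eps. Only the closeness of G to gam y0 is used, and y0 is expanded instead; the
    eps^2 in that closeness is O(N^-2) by eps <= C0 / N. *)
Lemma truncation_middle (i : nat) :
  (n <= S i <= 3 * n)%nat ->
  Rabs (truncation i) <= gam * K * (4 * (2 * exp 8 + C0 ^ 2) + 224) / INR N ^ 2.
Proof.
  intros Hi. pose proof (mesh_size_ge_4 n Hn : 4 <= INR N) as HN4.
  assert (Hlm' : 0 < lm <= 1 / 4) by (split; [apply transition_point_pos|exact Hlm]).
  assert (HiN : (S (S i) <= N)%nat) by (unfold N; lia).
  pose proof (mesh_range eps m n Hn Hlm' i ltac:(fold N; lia)) as R1.
  pose proof (mesh_range eps m n Hn Hlm' (S (S i)) ltac:(fold N; lia)) as R2.
  pose proof (mesh_outside_layers eps m n Hn Hlm' i Hi) as [O1 O2].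
  pose proof (hstep_variation eps m n Hn Hlm' i Hi) as Hvar.
  pose proof (hstep_bounds eps m n Hn Hlm' i ltac:(fold N; lia)) as [_ B1].
  pose proof (hstep_bounds eps m n Hn Hlm' (S i) ltac:(fold N; lia)) as [_ B2].
  fold N in R1, R2, O1, O2, Hvar, B1, B2. fold X in R1, R2, O1, O2. fold h in Hvar, B1, B2.
  fold lm in O1, O2.
  pose proof (hstep_pos i ltac:(lia)) as H1. pose proof (hstep_pos (S i) ltac:(lia)) as H2.
  assert (X0 : X i = X (S i) - h i) by (unfold h, hstep, X; ring).
  assert (X2 : X (S (S i)) = X (S i) + h (S i)) by (unfold h, hstep, X; ring).
  set (x := X (S i)) in *.
  assert (Hx : 0 < x < 1) by lra.
  assert (Hmu : 0 < mu) by (apply Rdiv_lt_0_compat; [now apply sqrt_lt_R0|lra]).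
  pose proof (exp_pos 8) as He8.
  set (r := / INR N ^ 2).
  assert (Hr : 0 < r) by (apply Rinv_0_lt_compat; nra).
  (* exp (- mu s) <= exp (8 - 2 l) = exp 8 / N^2, with 8 for the layer step lost at the transition
     point. *)
  assert (Hsmall : forall s, lm - lm / INR n <= s -> exp (- (mu * s)) <= exp 8 * r).
  { intros s Hs. apply Rle_trans with (exp (8 + - (2 * l))).
    - apply exp_le. pose proof layer_step_scaled. pose proof transition_point.
      assert (mu * (lm - lm / INR n) <= mu * s) by (apply Rmult_le_compat_l; lra). lra.
    - rewrite exp_plus, exp_Ropp. right. f_equal. unfold r. f_equal.
      replace (2 * l) with (l + l) by ring. rewrite exp_plus. unfold l.
      rewrite exp_ln by lra. ring. }
  assert (Hlayer : forall t, X i <= t <= X (S (S i)) -> layer mu t <= 2 * exp 8 * r).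
  { intros t Ht. unfold layer.
    pose proof (Hsmall t ltac:(lra)). pose proof (Hsmall (1 - t) ltac:(lra)). lra. }
  assert (Heps2 : eps ^ 2 <= C0 ^ 2 * r).
  { replace (C0 ^ 2 * r) with ((C0 / INR N) ^ 2) by (unfold r; field; lra).
    apply pow_incr. lra. }
  set (eta := 2 * gam * (K * ((2 * exp 8 + C0 ^ 2) * r)) + gam * K * (64 * r)).
  destruct (Hy0d x Hx) as (_ & _ & Hdx & _).
  assert (HT : Rabs (truncation i)
    <= 2 * eta + 2 * Rabs (gam * dy0 x) * Rabs (h i - h (S i))).
  { apply (truncation_bound i (gam * y0 x) (gam * dy0 x) eta HiN). fold x.
    intros t Ht.
    replace (G t - (gam * y0 x + gam * dy0 x * (t - x)))
      with ((G t - gam * y0 t) + gam * (y0 t - y0 x - dy0 x * (t - x))) by ring.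
    eapply Rle_trans; [apply Rabs_triang|]. unfold eta. apply Rplus_le_compat.
    - apply Rle_trans with (1 := Hnear t ltac:(lra)).
      apply Rmult_le_compat_l; [lra|]. apply Rmult_le_compat_l; [lra|].
      pose proof (Hlayer t Ht). lra.
    - rewrite Rabs_mult, (Rabs_pos_eq gam) by lra. rewrite Rmult_assoc.
      apply Rmult_le_compat_l; [lra|].
      apply Rle_trans with (K * (t - x) ^ 2).
      + apply (taylor_first_order y0 dy0 ddy0 (X i) (X (S (S i)))); try lra.
        * intros s _. apply Hy0c.
        * intros s Hs. apply Hy0d. lra.
        * intros s Hs. apply Hy0d. lra.
        * intros s Hs. apply Hy0d. lra.
      + apply Rmult_le_compat_l; [lra|].
        replace (64 * r) with ((8 / INR N) ^ 2) by (unfold r; field; lra).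
        rewrite <- (pow2_abs (t - x)). apply pow_incr. split; [apply Rabs_pos|].
        apply Rabs_le. lra. }
  apply Rle_trans with (1 := HT).
  assert (HV : Rabs (gam * dy0 x) * Rabs (h i - h (S i)) <= gam * K * (48 * r)).
  { rewrite Rabs_mult, (Rabs_pos_eq gam) by lra.
    apply Rmult_le_compat; try apply Rabs_pos.
    - apply Rmult_le_pos; [lra|apply Rabs_pos].
    - apply Rmult_le_compat_l; lra.
    - exact Hvar. }
  (* 224 = 2 * 64 + 2 * 48: squared cell length (8 / N)^2 and step variation 48 / N^2. *)
  unfold eta. unfold Rdiv. fold r. lra.
Qed.

End Truncation.

(** * Convergence *)

(** Since 3 a1 + d1 + D2 = 4 a1 + D1 + D2, and likewise with indices exchanged, the differences in
    the bracket equal (D1 + D2) (w0 + 2 w1 + w2) - 4 [fitted]. The first part joins the values of f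
    to form gam y - f. *)
Lemma scheme_fitted_form (a1 a2 d1 d2 D1 D2 w0 w1 w2 f0 f1 f2 gam : R) :
  D1 = d1 - a1 -> D2 = d2 - a2 -> 0 < gam -> 0 < D1 + D2 ->
  gam / (D1 + D2) *
    ((3 * a1 + d1 + D2) * (w0 - w1) - (3 * a2 + d2 + D1) * (w1 - w2)
     - (f0 + 2 * f1 + f2) / gam * (D1 + D2)) = 0 ->
  gam * fitted a1 a2 D1 D2 w0 w1 w2 / (D1 + D2)
    = ((gam * w0 - f0) + 2 * (gam * w1 - f1) + (gam * w2 - f2)) / 4.
Proof.
  intros E1 E2 Hg HD E.
  replace d1 with (D1 + a1) in E by lra. replace d2 with (D2 + a2) in E by lra.
  match type of E with ?e = 0 => replace e with
    (((gam * w0 - f0) + 2 * (gam * w1 - f1) + (gam * w2 - f2))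
     - 4 * (gam * fitted a1 a2 D1 D2 w0 w1 w2 / (D1 + D2))) in E end.
  - lra.
  - unfold fitted. field. lra.
Qed.

(** With t = c l: exp t = (exp (t / 2))^2 >= (t / 2)^2. *)
Lemma sq_exp_neg_bounded (c l : R) : 0 < c -> 0 <= l -> l ^ 2 * exp (- (c * l)) <= 4 / c ^ 2.
Proof.
  intros Hc Hl. rewrite exp_Ropp. pose proof (exp_pos (c * l)) as He.
  assert (H : (c * l / 2) ^ 2 <= exp (c * l)).
  { replace (c * l) with (c * l / 2 + c * l / 2) at 2 by field. rewrite exp_plus.
    pose proof (exp_ineq1_le (c * l / 2)). assert (0 <= c * l / 2) by nra. nra. }
  apply Rmult_le_reg_r with (exp (c * l)); [assumption|].
  rewrite Rmult_assoc, Rinv_l, Rmult_1_r by lra.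
  replace (l ^ 2) with (4 / c ^ 2 * (c * l / 2) ^ 2) by (field; lra).
  apply Rmult_le_compat_l; [apply Rdiv_le_0_compat; nra|assumption].
Qed.

Lemma acoef_S (gam eps m : R) (N i : nat) :
  acoef gam eps m N (S i) = / sinh (beta gam eps * hstep eps m N i).
Proof. unfold acoef. now rewrite Nat.sub_succ, Nat.sub_0_r. Qed.

Lemma Ddcoef_S (gam eps m : R) (N i : nat) :
  Ddcoef gam eps m N (S i) = tanh_half (beta gam eps * hstep eps m N i).
Proof. unfold Ddcoef, dcoef, acoef, tanh_half. now rewrite Nat.sub_succ, Nat.sub_0_r. Qed.

Section NodalError.

Variables (f : R -> R -> R) (eps m gam CT : R) (n : nat) (u : R -> R) (yb : nat -> R).
Let N := (4 * n)%nat.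
Let X := mesh eps m N.
Let mu := sqrt m / eps.
Let l := ln (INR N).
Let a := acoef gam eps m N.
Let D := Ddcoef gam eps m N.
Let th := m / (4 * gam).
Let w := decay th D.
Hypothesis Hn : (0 < n)%nat.
Hypothesis Hlm : lam eps m N <= 1 / 4.
Hypothesis Heps : 0 < eps < 1.
Hypothesis Hm : 0 < m <= gam.

Lemma barrier_rate : 0 < th <= 1.
Proof.
  unfold th. split; [apply Rdiv_lt_0_compat; lra|].
  apply Rmult_le_reg_r with (4 * gam); [lra|].
  unfold Rdiv. rewrite Rmult_assoc, Rinv_l by lra. lra.
Qed.

Lemma coefficient_bounds (i : nat) : (1 <= i <= N)%nat ->
  0 < a i /\ 0 < D i < 1 /\ a i * D i = (1 - D i ^ 2) / 2.
Proof.
  intros Hi. destruct i as [|i]; [lia|].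
  unfold a, D. rewrite acoef_S, Ddcoef_S.
  assert (Hp : 0 < beta gam eps * hstep eps m N i)
    by (apply (scaled_step_pos eps m gam n Hn Hlm Heps); try lra; fold N; lia).
  split; [apply Rinv_0_lt_compat; now apply sinh_pos|].
  split; [split; [now apply tanh_half_pos|now apply tanh_half_lt_1]|].
  now apply inv_sinh_tanh_half.
Qed.

Lemma fitting_coefficient_range (i : nat) : (1 <= i <= N)%nat -> 0 < D i < 1.
Proof. intros Hi. now apply coefficient_bounds. Qed.

Lemma barrier_left (i : nat) : (S (S i) <= N)%nat ->
  (gam - m) * ((w i + 2 * w (S i) + w (S (S i))) / 4) + m / 2 * w (S i)
    <= gam * fitted (a (S i)) (a (S (S i))) (D (S i)) (D (S (S i)))
               (w i) (w (S i)) (w (S (S i))) / (D (S i) + D (S (S i))).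
Proof.
  intros Hi.
  destruct (coefficient_bounds (S i) ltac:(lia)) as (_ & H1 & H2).
  destruct (coefficient_bounds (S (S i)) ltac:(lia)) as (_ & H3 & H4).
  apply barrier_supersolution with th; try assumption; try reflexivity.
  - apply (decay_step th D N barrier_rate fitting_coefficient_range). lia.
  - apply (decay_step th D N barrier_rate fitting_coefficient_range). lia.
  - apply (decay_pos th D N barrier_rate fitting_coefficient_range). lia.
Qed.

(** Coefficient j belongs to the step from node j - 1 to node j, so reflection of the mesh exchanges
    S i and N - i. *)
Lemma coefficients_symmetric (i : nat) : (i < N)%nat ->
  a (N - i) = a (S i) /\ D (N - i) = D (S i).
Proof.
  intros Hi. replace (N - i)%nat with (S (N - 1 - i)) by lia.
  unfold a, D. rewrite !acoef_S, !Ddcoef_S.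
  now rewrite (hstep_symmetric eps m n Hn i Hi : hstep eps m N (N - 1 - i) = _).
Qed.

Lemma barrier_right (i : nat) : (S (S i) <= N)%nat ->
  (gam - m) * ((w (N - i) + 2 * w (N - S i) + w (N - S (S i))) / 4) + m / 2 * w (N - S i)
    <= gam * fitted (a (S i)) (a (S (S i))) (D (S i)) (D (S (S i)))
               (w (N - i)) (w (N - S i)) (w (N - S (S i))) / (D (S i) + D (S (S i))).
Proof.
  intros Hi.
  pose proof (barrier_left (N - S (S i)) ltac:(lia)) as H.
  replace (S (S (N - S (S i)))) with (N - i)%nat in H by lia.
  replace (S (N - S (S i))) with (N - S i)%nat in H by lia.
  destruct (coefficients_symmetric i ltac:(lia)) as [Ea1 ED1].
  destruct (coefficients_symmetric (S i) ltac:(lia)) as [Ea2 ED2].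
  rewrite Ea1, ED1, Ea2, ED2, fitted_swap in H.
  rewrite (Rplus_comm (D (S i))).
  replace (w (N - i) + 2 * w (N - S i) + w (N - S (S i)))
    with (w (N - S (S i)) + 2 * w (N - S i) + w (N - i)) by ring.
  exact H.
Qed.

(** The barrier decays no faster than exp (- th beta x), by tanh (t / 2) <= t, and th beta = m / (4
    sqrt gam eps) <= mu because m <= gam. *)
Lemma layer_le_barrier (i : nat) : (i <= N)%nat -> layer mu (X i) <= w i + w (N - i).
Proof.
  assert (Hlm' : 0 < lam eps m N <= 1 / 4).
  { split; [apply (transition_point_pos eps m n Hn Heps); lra|exact Hlm]. }
  assert (Hb : 0 < beta gam eps).
  { apply Rdiv_lt_0_compat; [apply sqrt_lt_R0; lra|lra]. }
  assert (Hmu : th * beta gam eps <= mu).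
  { unfold th, mu, beta.
    pose proof (sqrt_lt_R0 m ltac:(lra)). pose proof (sqrt_lt_R0 gam ltac:(lra)).
    pose proof (sqrt_le_1 m gam ltac:(lra) ltac:(lra) ltac:(lra)).
    replace (m / (4 * gam) * (sqrt gam / eps)) with (m / (4 * gam) * sqrt gam / eps)
      by (unfold Rdiv; ring).
    apply Rmult_le_compat_r; [left; apply Rinv_0_lt_compat; lra|].
    apply Rmult_le_reg_r with (4 * gam); [lra|].
    replace (m / (4 * gam) * sqrt gam * (4 * gam)) with (m * sqrt gam) by (field; lra).
    pose proof (sqrt_sqrt m ltac:(lra)) as E1. pose proof (sqrt_sqrt gam ltac:(lra)) as E2.
    set (p := sqrt m) in *. set (r := sqrt gam) in *. rewrite <- E1, <- E2.
    assert (p * r <= r * r) by nra. nra. }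
  assert (Hleft : forall i, (i <= N)%nat -> exp (- (mu * X i)) <= w i).
  { intros k Hk. apply Rle_trans with (exp (- (th * beta gam eps * X k))).
    - apply exp_le. pose proof (mesh_range eps m n Hn Hlm' k Hk) as HX.
      fold N in HX. fold X in HX. nra.
    - apply (decay_lower_bound th D N barrier_rate fitting_coefficient_range); try assumption.
      + exact (mesh_0 eps m n Hn).
      + intros j Hj. unfold D. rewrite Ddcoef_S.
        change (X (S j) - X j) with (hstep eps m N j). apply tanh_half_le_id.
        apply (scaled_step_pos eps m gam n Hn Hlm Heps); try lra. fold N; lia. }
  intros Hi. unfold layer.
  pose proof (Hleft i Hi). pose proof (Hleft (N - i)%nat ltac:(lia)) as H2.
  rewrite (mesh_symmetric eps m n Hn i Hi : X (N - i) = 1 - X i) in H2. lra.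
Qed.

(** In the layer beta h = 8 s l / N <= 8 s, hence D_i >= (8 s l / N) / (cosh (8 s) + 1). The n = N /
    4 layer steps give w n <= exp (- c l) = N^-c, with c the quantity squared on the right. *)
Lemma barrier_after_layer :
  let s := sqrt gam / sqrt m in
  l ^ 2 * w n <= 4 / (th * s / (cosh (8 * s) + 1)) ^ 2.
Proof.
  intros s. pose proof barrier_rate as Hth.
  pose proof (log_mesh_size n Hn : 1 <= l <= INR N) as Hl.
  pose proof (mesh_size_ge_4 n Hn : 4 <= INR N) as HN.
  pose proof (sqrt_lt_R0 m ltac:(lra)) as Hsm. pose proof (sqrt_lt_R0 gam ltac:(lra)) as Hsg.
  assert (Hs : 0 < s) by now apply Rdiv_lt_0_compat.
  pose proof (cosh_ge_1 (8 * s)) as Hch.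
  set (c := th * s / (cosh (8 * s) + 1)).
  assert (Hc : 0 < c) by (apply Rdiv_lt_0_compat; nra).
  set (tau := 8 * s * (l / INR N)).
  assert (HlN : 0 < l / INR N <= 1).
  { split; [apply Rdiv_lt_0_compat; lra|]. apply Rmult_le_reg_r with (INR N); [lra|].
    unfold Rdiv. rewrite Rmult_assoc, Rinv_l by lra. lra. }
  assert (Htau : 0 < tau <= 8 * s) by (unfold tau; nra).
  apply Rle_trans with (2 := sq_exp_neg_bounded c l Hc ltac:(lra)).
  apply Rmult_le_compat_l; [nra|].
  replace (- (c * l)) with (- (th * (tau / (cosh (8 * s) + 1)) / 2 * INR n)).
  2: { assert (E : INR N = 4 * INR n) by (unfold N; rewrite mult_INR; simpl; ring).
       unfold tau, c. rewrite E. assert (0 < INR n) by now apply lt_0_INR. field. lra. }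
  apply (decay_upper_bound th D N barrier_rate fitting_coefficient_range).
  - apply Rdiv_lt_0_compat; lra.
  - intros j Hj. destruct j as [|j]; [lia|]. unfold D. rewrite Ddcoef_S.
    unfold N. rewrite (hstep_layer eps m n Hn j) by lia.
    rewrite (layer_step eps m n Hn Heps ltac:(lra)).
    replace (beta gam eps * _) with tau.
    + now apply tanh_half_ge_linear.
    + unfold tau, beta, s. fold N. fold l. field. lra.
  - unfold N; lia.
Qed.

Variable G : R -> R.
Hypothesis HG : forall x, 0 <= x <= 1 -> G x = gam * u x - f x (u x).
Hypothesis Hu0 : u 0 = 0.
Hypothesis Hu1 : u 1 = 0.
Hypothesis Hmono : forall x y1 y2, 0 <= x <= 1 -> y1 <= y2 ->
  m * (y2 - y1) <= f x y2 - f x y1 <= gam * (y2 - y1).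
Hypothesis Hscheme : is_scheme_solution f gam eps m N yb.
Hypothesis HCT : 0 < CT.
Hypothesis Htr : forall i, (S (S i) <= N)%nat ->
  Rabs (truncation eps m gam n u G i)
    <= CT * (/ INR N ^ 2 + (l / INR N) ^ 2 * layer mu (X (S i))).

Lemma nodal_error_bound (i : nat) : (i <= N)%nat ->
  Rabs (u (X i) - yb i)
    <= CT / m * / INR N ^ 2 + 2 * CT / m * (l / INR N) ^ 2 * (w i + w (N - i)).
Proof.
  assert (Hlm' : 0 < lam eps m N <= 1 / 4).
  { split; [apply (transition_point_pos eps m n Hn Heps); lra|exact Hlm]. }
  pose proof (mesh_size_ge_4 n Hn : 4 <= INR N) as HN.
  destruct Hscheme as (Hy0 & HyN & Hsch).
  (* P and Q are the smallest values for which the margins m (for constants) and m / 2 (for w and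
     its mirror image) cover the two parts of the truncation bound. *)
  set (P := CT / m * / INR N ^ 2). set (Q := 2 * CT / m * (l / INR N) ^ 2).
  assert (HCm : 0 < CT / m) by (apply Rdiv_lt_0_compat; lra).
  assert (HP : 0 < P) by (apply Rmult_lt_0_compat; [|apply Rinv_0_lt_compat]; nra).
  assert (HQ : 0 <= Q).
  { apply Rmult_le_pos; [|apply pow2_ge_0]. apply Rdiv_le_0_compat; lra. }
  assert (HmP : m * P = CT * / INR N ^ 2) by (unfold P; field; lra).
  assert (HmQ : m / 2 * Q = CT * (l / INR N) ^ 2) by (unfold Q; field; lra).
  set (z := fun i => P + Q * (w i + w (N - i))).
  set (e := fun i => u (X i) - yb i).
  set (del := fun i => gam * e i - (f (X i) (u (X i)) - f (X i) (yb i))).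
  (* A shift from left neighbours to nodes; the value at 0 is a default. *)
  set (T := fun i => match i with O => 0 | S j => truncation eps m gam n u G j end).
  assert (Hwpos : forall i, (i <= N)%nat -> 0 < w i).
  { apply (decay_pos th D N barrier_rate fitting_coefficient_range). }
  assert (Hz : forall i, (i <= N)%nat -> 0 <= z i).
  { intros k Hk. unfold z. pose proof (Hwpos k Hk). pose proof (Hwpos (N - k)%nat ltac:(lia)).
    assert (0 <= Q * (w k + w (N - k))) by (apply Rmult_le_pos; lra). lra. }
  assert (HX : forall i, (i <= N)%nat -> 0 <= X i <= 1)
    by exact (mesh_range eps m n Hn Hlm').
  assert (HaD : forall i, (1 <= i <= N)%nat -> 0 < a i /\ 0 < D i).
  { intros k Hk. destruct (coefficient_bounds k Hk) as (H1 & [H2 _] & _). now split. }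
  (* del lies between 0 and (gam - m) e. Both signs are recorded because the comparison is applied
     to e and to - e. *)
  assert (Hdel : forall i, (i <= N)%nat ->
    del i <= (gam - m) * Rmax (e i) 0 /\ - del i <= (gam - m) * Rmax (- e i) 0).
  { intros k Hk. unfold del. destruct (Rle_lt_dec 0 (e k)) as [H|H].
    - rewrite (Rmax_left (e k)), (Rmax_right (- e k)) by lra. unfold e in *.
      pose proof (Hmono (X k) (yb k) (u (X k)) (HX k Hk) ltac:(lra)). lra.
    - rewrite (Rmax_right (e k)), (Rmax_left (- e k)) by lra. unfold e in *.
      pose proof (Hmono (X k) (u (X k)) (yb k) (HX k Hk) ltac:(lra)). lra. }
  assert (He0 : e 0%nat = 0).
  { unfold e. rewrite Hy0. replace (X 0) with 0 by (symmetry; exact (mesh_0 eps m n Hn)). lra. }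
  assert (HeN : e N = 0).
  { unfold e. rewrite HyN. replace (X N) with 1 by (symmetry; exact (mesh_N eps m n Hn)). lra. }
  assert (Heq : forall i, (S (S i) <= N)%nat ->
     gam * fitted (a (S i)) (a (S (S i))) (D (S i)) (D (S (S i)))
             (e i) (e (S i)) (e (S (S i))) / (D (S i) + D (S (S i)))
     = (del i + 2 * del (S i) + del (S (S i))) / 4 + T (S i)).
  { intros k Hk.
    pose proof (proj2 (HaD (S k) ltac:(lia))) as HD1.
    pose proof (proj2 (HaD (S (S k)) ltac:(lia))) as HD2.
    specialize (Hsch (S k) ltac:(lia)). cbv zeta in Hsch.
    replace (S k - 1)%nat with k in Hsch by lia.
    apply scheme_fitted_form in Hsch; try reflexivity; [|lra|fold D; lra].
    fold a in Hsch. fold D in Hsch. fold X in Hsch.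
    assert (ET : T (S k) = gam * fitted (a (S k)) (a (S (S k))) (D (S k)) (D (S (S k)))
        (u (X k)) (u (X (S k))) (u (X (S (S k)))) / (D (S k) + D (S (S k)))
        - (G (X k) + 2 * G (X (S k)) + G (X (S (S k)))) / 4).
    { unfold T, truncation, a, D. rewrite !acoef_S, !Ddcoef_S. reflexivity. }
    rewrite ET, !HG by (apply HX; lia).
    replace (gam * fitted (a (S k)) (a (S (S k))) (D (S k)) (D (S (S k)))
               (e k) (e (S k)) (e (S (S k))) / (D (S k) + D (S (S k))))
      with (gam * fitted (a (S k)) (a (S (S k))) (D (S k)) (D (S (S k)))
              (u (X k)) (u (X (S k))) (u (X (S (S k)))) / (D (S k) + D (S (S k)))
            - gam * fitted (a (S k)) (a (S (S k))) (D (S k)) (D (S (S k)))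
                (yb k) (yb (S k)) (yb (S (S k))) / (D (S k) + D (S (S k)))).
    2: { unfold fitted, e. field. lra. }
    rewrite Hsch. unfold del, e. field. lra. }
  assert (Hsup : forall i, (S (S i) <= N)%nat ->
     (gam - m) * ((z i + 2 * z (S i) + z (S (S i))) / 4) + Rabs (T (S i))
     <= gam * fitted (a (S i)) (a (S (S i))) (D (S i)) (D (S (S i)))
              (z i) (z (S i)) (z (S (S i))) / (D (S i) + D (S (S i)))).
  { intros k Hk.
    pose proof (proj2 (HaD (S k) ltac:(lia))) as HD1.
    pose proof (proj2 (HaD (S (S k)) ltac:(lia))) as HD2.
    pose proof (barrier_left k Hk) as BL. pose proof (barrier_right k Hk) as BR.
    replace (gam * fitted (a (S k)) (a (S (S k))) (D (S k)) (D (S (S k)))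
              (z k) (z (S k)) (z (S (S k))) / (D (S k) + D (S (S k))))
      with (gam * P
        + Q * (gam * fitted (a (S k)) (a (S (S k))) (D (S k)) (D (S (S k)))
               (w k) (w (S k)) (w (S (S k))) / (D (S k) + D (S (S k))))
        + Q * (gam * fitted (a (S k)) (a (S (S k))) (D (S k)) (D (S (S k)))
               (w (N - k)) (w (N - S k)) (w (N - S (S k))) / (D (S k) + D (S (S k)))))
      by (unfold fitted, z; field; lra).
    apply Rmult_le_compat_l with (r := Q) in BL; [|assumption].
    apply Rmult_le_compat_l with (r := Q) in BR; [|assumption].
    pose proof (Htr k Hk) as HT.
    change (truncation eps m gam n u G k) with (T (S k)) in HT.
    pose proof (layer_le_barrier (S k) ltac:(lia)) as HLb.
    assert (HT' : Rabs (T (S k)) <= m * P + m / 2 * Q * (w (S k) + w (N - S k))).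
    { apply Rle_trans with (1 := HT). rewrite HmP, HmQ, Rmult_plus_distr_l.
      apply Rplus_le_compat_l. rewrite <- Rmult_assoc.
      apply Rmult_le_compat_l; [|exact HLb].
      apply Rmult_le_pos; [lra|apply pow2_ge_0]. }
    unfold z. lra. }
  intros Hi. fold (e i). fold (z i). apply Rabs_le. split.
  - enough (- e i <= z i) by lra.
    apply (discrete_comparison N a D (fun k => - e k) z (fun k => - del k) (fun k => - T k) gam m);
      try assumption; try lra.
    + intros k Hk. now apply Hdel.
    + intros k Hk. specialize (Heq k Hk).
      replace (gam * fitted (a (S k)) (a (S (S k))) (D (S k)) (D (S (S k)))
               (- e k) (- e (S k)) (- e (S (S k))) / (D (S k) + D (S (S k))))
        with (- (gam * fitted (a (S k)) (a (S (S k))) (D (S k)) (D (S (S k)))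
               (e k) (e (S k)) (e (S (S k))) / (D (S k) + D (S (S k)))))
        by (unfold fitted, Rdiv; ring).
      lra.
    + intros k Hk. apply Rle_trans with (2 := Hsup k Hk).
      apply Rplus_le_compat_l. rewrite <- Rabs_Ropp. apply Rle_abs.
  - apply (discrete_comparison N a D e z del T gam m); try assumption.
    + intros k Hk. now apply Hdel.
    + intros k Hk. apply Rle_trans with (2 := Hsup k Hk).
      apply Rplus_le_compat_l, Rle_abs.
Qed.

End NodalError.

Theorem theorem3 :
  forall (f : R -> R -> R) (m gam C0 : R),
    C2_strip f ->
    0 < m ->
    (forall x y, 0 <= x <= 1 -> m <= dfdy f x y) ->
    (forall x y, 0 <= x <= 1 -> dfdy f x y <= gam) ->
    exists C : R, 0 < C /\
      forall (eps : R) (N : nat) (u : R -> R) (yb : nat -> R),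
        0 < eps < 1 ->
        (0 < N)%nat -> Nat.modulo N 4 = 0%nat ->
        lam eps m N <= q ->
        eps <= C0 / INR N ->
        is_bvp_solution eps f u ->
        is_scheme_solution f gam eps m N yb ->
        forall i : nat, (i <= N)%nat ->
          Rabs (u (mesh eps m N i) - yb i) <=
            (if Nat.ltb i (N / 4) then C * ln (INR N) ^ 2 / INR N ^ 2
             else if Nat.leb i (3 * N / 4) then C / INR N ^ 2
             else C * ln (INR N) ^ 2 / INR N ^ 2).
Proof.
  intros f m gam C0 (fx & fy & fxx & fxy & fyx & fyy & Hdx & Hdy & Hcont) Hm Hlo' Hhi'.
  assert (Hfy : forall x y, 0 <= x <= 1 -> dfdy f x y = fy x y).
  { intros x y Hx. apply is_derive_unique. now apply Hdy. }
  assert (Hlo : forall x y, 0 <= x <= 1 -> m <= fy x y).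
  { intros x y Hx. rewrite <- Hfy by assumption. now apply Hlo'. }
  assert (Hhi : forall x y, 0 <= x <= 1 -> fy x y <= gam).
  { intros x y Hx. rewrite <- Hfy by assumption. now apply Hhi'. }
  assert (Hmg : 0 < m <= gam).
  { pose proof (Hlo 0 0 ltac:(lra)). pose proof (Hhi 0 0 ltac:(lra)). lra. }
  destruct (solution_estimates f fx fy fxx fxy fyx fyy m gam Hdx Hdy Hcont Hm Hlo Hhi)
    as (y0 & dy0 & ddy0 & K & HK & Hroot & Hy0c & Hy0d & Hest).
  pose proof (exp_pos 8) as He8.
  set (CT1 := 2 * K * (1 + 64 * exp 8 / m)).
  set (CT2 := gam * K * (4 * (2 * exp 8 + C0 ^ 2) + 224)).
  assert (He8m : 0 < 64 * exp 8 / m) by (apply Rdiv_lt_0_compat; lra).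
  assert (HCT1 : 0 < CT1) by (unfold CT1; nra).
  assert (HCT2 : 0 < CT2).
  { unfold CT2. apply Rmult_lt_0_compat; [nra|]. pose proof (pow2_ge_0 C0). lra. }
  set (CT := CT1 + CT2).
  set (s := sqrt gam / sqrt m).
  set (c := m / (4 * gam) * s / (cosh (8 * s) + 1)).
  assert (Hs : 0 < s) by (apply Rdiv_lt_0_compat; apply sqrt_lt_R0; lra).
  assert (Hc : 0 < c).
  { pose proof (cosh_ge_1 (8 * s)). apply Rdiv_lt_0_compat; [|lra].
    apply Rmult_lt_0_compat; [apply Rdiv_lt_0_compat|]; lra. }
  assert (HCm : 0 < CT / m) by (apply Rdiv_lt_0_compat; unfold CT; lra).
  assert (Hcc : 0 < 4 / c ^ 2) by (apply Rdiv_lt_0_compat; nra).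
  (* In the layers w <= 1 requires 1 + 2 (1 + 1) = 5; between them l^2 w <= 4 / c^2 requires 1 + 4
     (4 / c^2). The sum serves both. *)
  exists (CT / m * (5 + 4 * (4 / c ^ 2))). split; [apply Rmult_lt_0_compat; lra|].
  intros eps N u yb Heps HN Hmod Hlm HepsN Hbvp Hscheme i Hi.
  destruct (proj1 (Nat.Div0.mod_divides N 4) Hmod) as [n ->].
  assert (Hn : (0 < n)%nat) by lia.
  unfold q in Hlm.
  destruct (Hest eps u Heps Hbvp) as (Hcl & du & ddu & dG & ddG & Hder).
  set (G := fun t => gam * u t - f (clamp t) (u t)) in *.
  set (mu := sqrt m / eps) in *.
  pose proof (mesh_size_ge_4 n Hn) as HN4. pose proof (log_mesh_size n Hn) as Hl.
  set (RN := INR (4 * n)) in *. set (l := ln RN) in *.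
  assert (HG : forall x, 0 <= x <= 1 -> G x = gam * u x - f x (u x)).
  { intros x Hx. unfold G. now rewrite clamp_id. }
  assert (HGy : forall x, 0 <= x <= 1 ->
    Rabs (G x - gam * y0 x) <= 2 * gam * (K * (layer mu x + eps ^ 2))).
  { intros x Hx. destruct (Hcl x Hx) as (_ & _ & Hb).
    rewrite HG by assumption.
    replace (gam * u x - f x (u x) - gam * y0 x)
      with (gam * (u x - y0 x) - (f x (u x) - f x (y0 x))) by (rewrite Hroot by assumption; ring).
    pose proof (reaction_lipschitz f fx fy fxy fyy m gam Hdy Hm Hlo Hhi x (y0 x) (u x) Hx) as HLip.
    unfold Rminus at 1. eapply Rle_trans; [apply Rabs_triang|].
    rewrite Rabs_Ropp, Rabs_mult, (Rabs_pos_eq gam) by lra.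
    assert (gam * Rabs (u x - y0 x) <= gam * (K * (layer mu x + eps ^ 2)))
      by (apply Rmult_le_compat_l; lra).
    lra. }
  assert (HuG : forall x, 0 <= x <= 1 -> continuity_pt u x /\ continuity_pt G x).
  { intros x Hx. destruct (Hcl x Hx) as (H1 & H2 & _). now split. }
  assert (Hr : 0 < / RN ^ 2) by (apply Rinv_0_lt_compat; nra).
  assert (Htr : forall k, (S (S k) <= 4 * n)%nat -> Rabs (truncation eps m gam n u G k)
      <= CT * (/ RN ^ 2 + (l / RN) ^ 2 * layer mu (mesh eps m (4 * n) (S k)))).
  { intros k Hk. pose proof (layer_pos mu (mesh eps m (4 * n) (S k))) as HLp.
    set (Lk := layer mu (mesh eps m (4 * n) (S k))) in *.
    pose proof (pow2_ge_0 (l / RN)) as Hp2. set (p2 := (l / RN) ^ 2) in *.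
    assert (Hp : 0 <= p2 * Lk) by (apply Rmult_le_pos; lra).
    destruct (Nat.lt_ge_cases (S k) n) as [H1|H1];
      [|destruct (Nat.lt_ge_cases (3 * n) (S k)) as [H2|H2]].
    1, 2: apply Rle_trans with (2 * K * (/ RN ^ 2 + 64 * exp 8 / m * p2 * Lk));
      [apply (truncation_layer eps m gam K n Hn Hlm Heps Hm ltac:(lra) HK
                u du ddu G dG ddG HuG Hder k Hk); lia|].
    1, 2: apply Rle_trans with (CT1 * (/ RN ^ 2 + p2 * Lk)); [unfold CT1|unfold CT; nra].
    1, 2: rewrite !(Rmult_assoc (2 * K)); apply Rmult_le_compat_l; [lra|];
      rewrite (Rmult_assoc (64 * exp 8 / m)); nra.
    apply Rle_trans with (CT2 * / RN ^ 2).
    - apply (truncation_middle eps m gam K C0 n Hn Hlm Heps HepsN Hm ltac:(lra) HK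
        u du ddu G dG ddG HuG Hder y0 dy0 ddy0 Hy0c Hy0d HGy). lia.
    - unfold CT. nra. }
  assert (Hu01 : u 0 = 0 /\ u 1 = 0).
  { destruct Hbvp as (_ & u' & u'' & _ & H0 & H1). now split. }
  pose proof (nodal_error_bound f eps m gam CT n u yb Hn Hlm Heps Hmg G HG
    (proj1 Hu01) (proj2 Hu01)
    (reaction_strongly_monotone f fx fy fxy fyy m gam Hdy Hlo Hhi)
    Hscheme ltac:(unfold CT; lra) Htr i Hi) as Herr.
  fold RN in Herr. fold l in Herr.
  pose proof (barrier_after_layer eps m gam n Hn Hlm Heps Hmg) as Hwn. cbv zeta in Hwn.
  fold RN in Hwn. fold l in Hwn. fold s in Hwn. fold c in Hwn.
  pose proof (barrier_rate m gam Hmg) as Hth.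
  pose proof (fitting_coefficient_range eps m gam n Hn Hlm Heps Hmg) as HD.
  set (D := Ddcoef gam eps m (4 * n)) in *. set (th := m / (4 * gam)) in *.
  set (w := decay th D) in *.
  assert (Hl2 : 1 <= l ^ 2) by nra.
  replace (2 * CT / m * (l / RN) ^ 2) with (2 * (CT / m) * (l ^ 2 * / RN ^ 2)) in Herr
    by (field; lra).
  assert (Hwn0 : 0 < w n) by (apply (decay_pos th D (4 * n) Hth HD); lia).
  assert (Hlayer : Rabs (u (mesh eps m (4 * n) i) - yb i)
    <= CT / m * (5 + 4 * (4 / c ^ 2)) * l ^ 2 / RN ^ 2).
  { assert (W1 : w i <= 1) by (apply (decay_le_1 th D (4 * n) Hth HD); lia).
    assert (W2 : w (4 * n - i)%nat <= 1) by (apply (decay_le_1 th D (4 * n) Hth HD); lia).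
    apply Rle_trans with (1 := Herr).
    set (A := CT / m) in *. set (r := / RN ^ 2) in *.
    assert (HAr : 0 < A * r) by now apply Rmult_lt_0_compat.
    replace (A * (5 + 4 * (4 / c ^ 2)) * l ^ 2 / RN ^ 2)
      with (A * r * l ^ 2 * (5 + 4 * (4 / c ^ 2))) by (unfold r, Rdiv; ring).
    assert (H1 : A * r * 1 <= A * r * l ^ 2) by (apply Rmult_le_compat_l; lra).
    assert (H2 : 2 * A * (l ^ 2 * r) * (w i + w (4 * n - i)%nat) <= A * r * l ^ 2 * 4).
    { replace (2 * A * (l ^ 2 * r) * (w i + w (4 * n - i)%nat))
        with (A * r * l ^ 2 * (2 * (w i + w (4 * n - i)%nat))) by ring.
      apply Rmult_le_compat_l; lra. }
    assert (H3 : 0 <= A * r * l ^ 2 * (4 * (4 / c ^ 2))) by (apply Rmult_le_pos; lra).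
    lra. }
  replace (4 * n / 4)%nat with n by (rewrite Nat.mul_comm, Nat.div_mul; lia).
  replace (3 * (4 * n) / 4)%nat with (3 * n)%nat
    by (replace (3 * (4 * n))%nat with (3 * n * 4)%nat by lia; rewrite Nat.div_mul; lia).
  destruct (Nat.ltb_spec i n) as [H1|H1]; [exact Hlayer|].
  destruct (Nat.leb_spec i (3 * n)) as [H2|H2]; [|exact Hlayer].
  (* For n <= i <= 3 n both i and 4 n - i are at least n, so both barriers are past their layer. *)
  assert (W1 : w i <= w n) by (apply (decay_antitone th D (4 * n) Hth HD); lia).
  assert (W2 : w (4 * n - i)%nat <= w n) by (apply (decay_antitone th D (4 * n) Hth HD); lia).
  apply Rle_trans with (1 := Herr).
  set (A := CT / m) in *. set (r := / RN ^ 2) in *.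
  assert (HAr : 0 < A * r) by now apply Rmult_lt_0_compat.
  replace (A * (5 + 4 * (4 / c ^ 2)) / RN ^ 2)
    with (A * r * (5 + 4 * (4 / c ^ 2))) by (unfold r, Rdiv; ring).
  replace (2 * A * (l ^ 2 * r) * (w i + w (4 * n - i)%nat))
    with (A * r * (2 * (l ^ 2 * (w i + w (4 * n - i)%nat)))) by ring.
  assert (HH : l ^ 2 * (w i + w (4 * n - i)%nat) <= 2 * (4 / c ^ 2)).
  { apply Rle_trans with (l ^ 2 * (2 * w n)); [apply Rmult_le_compat_l; lra|lra]. }
  assert (A * r * (2 * (l ^ 2 * (w i + w (4 * n - i)%nat))) <= A * r * (2 * (2 * (4 / c ^ 2))))
    by (apply Rmult_le_compat_l; lra).
  lra.
Qed.
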